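(* Let $d,r:\mathbb{N}\to\mathbb{N}$ be functions such that $d$ is nondecreasing, $d$ takes only prime values at least $5$, $r$ is strictly increasing, and $3r(n)\le d(n)$ for all $n$. Let $\alpha_n=(1\;2\;\cdots\;d(n))$, $\beta_n=(1\;(1+r(n))\;(1+2r(n)))\in\mathrm{Alt}(d(n))$, $\alpha=(\alpha_n)_n,\beta=(\beta_n)_n\in\prod_n\mathrm{Alt}(d(n))$, and $G=\langle\alpha,\beta\rangle$. Then $G$ is (permutation) stable.
   Context: $\mathbb{N}=\{1,2,\dots\}$. For finite $\Omega$, $d_\Omega(\sigma,\tau)=|\{\omega:\sigma(\omega)\ne\tau(\omega)\}|/|\Omega|$. A finitely generated group $\Gamma$ is stable if, for an epimorphism $\pi:\mathbb{F}\twoheadrightarrow\Gamma$ from a free group on a finite basis $X$ (e.g. $\mathbb{F}_2\to G$ sending the basis to $\alpha,\beta$), for every $\epsilon>0$ there exist $\delta\in(0,1]$ and a finite $E\subseteq\ker\pi$ such that for every finite $\Omega$ and every homomorphism $\rho:\mathbb{F}\to\mathrm{Sym}(\Omega)$ with $d_\Omega(\rho(r),\mathrm{id})<\delta$ for all $r\in E$, there is a homomorphism $\phi:\Gamma\to\mathrm{Sym}(\Omega)$ with $d_\Omega(\rho(x),\phi(\pi(x)))<\epsilon$ for all $x\in X$ (this does not depend on the choice of $\pi$). *)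

(* Defs.v *)
From HB Require Import structures.
From mathcomp Require Import all_boot all_order all_algebra all_fingroup.
From mathcomp Require Import Rstruct.
Set Implicit Arguments. Unset Strict Implicit. Unset Printing Implicit Defensive.
Import GRing.Theory Num.Theory.
Local Open Scope ring_scope.

Notation Real := Rdefinitions.R.

(* Points of {1,...,m} are represented by 'I_m = {0,...,m-1} (point k+1 <-> k). *)

Definition alpha_perm (m : nat) : {perm 'I_m} := perm (@ordS_inj m).

(* beta_{m,r} = (1 (1+r) (1+2r)), i.e. 0 -> r -> 2r -> 0 (0-based).
   (In MathComp, (s * t) x = t (s x).) *)
Definition beta_perm (m r : nat) : {perm 'I_m} :=
  match m return {perm 'I_m} with
  | 0 => 1%g
  | m'.+1 => (tperm (inord 0) (inord r) * tperm (inord 0) (inord (2 * r)))%g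
  end.

(* Words in the free group F_2 on the basis {x, y}: a letter is
   (is_y, is_inverse).  Unreduced words represent free-group elements. *)
Definition letter := (bool * bool)%type.
Definition word := seq letter.

Definition ev_word (gT : finGroupType) (a b : gT) (w : word) : gT :=
  foldr (fun l acc => ((let g := if l.1 then b else a in
                        if l.2 then g^-1 else g) * acc)%g) 1%g w.

Definition prodSym (m : nat -> nat) := forall n, {perm 'I_(m n)}.
Definition prod_mul (m : nat -> nat) (g h : prodSym m) : prodSym m :=
  fun n => (g n * h n)%g.

Definition in_ker (m : nat -> nat) (a b : prodSym m) (w : word) : Prop :=
  forall n, ev_word (a n) (b n) w = 1%g.

Definition in_gen (m : nat -> nat) (a b : prodSym m) (g : prodSym m) : Prop :=
  exists w : word, forall n, g n = ev_word (a n) (b n) w.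

Definition hdist (Omega : finType) (s t : {perm Omega}) : Real :=
  (#|[set x | s x != t x]|%:R / #|Omega|%:R)%R.

(* Permutation stability of G = <a, b>, w.r.t. pi : F_2 ->> G (x |-> a, y |-> b).
   A homomorphism rho : F_2 -> Sym(Omega) is given by the images s, t of the basis;
   rho(w) = ev_word s t w. *)
Definition perm_stable (m : nat -> nat) (a b : prodSym m) : Prop :=
  forall eps : Real, 0 < eps ->
  exists delta : Real, 0 < delta <= 1 /\
  exists E : seq word, (forall w, w \in E -> in_ker a b w) /\
  forall (Omega : finType) (s t : {perm Omega}),
    (forall w, w \in E -> hdist (ev_word s t w) 1%g < delta) ->
    exists phi : prodSym m -> {perm Omega},
      (forall g h, in_gen a b g -> in_gen a b h ->
         phi (prod_mul g h) = (phi g * phi h)%g) /\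
      hdist s (phi a) < eps /\ hdist t (phi b) < eps.

(* Main.v *)
(* Write G for the group of alpha and beta.  For k large, G is the direct product of the finite group
   Q = <u, v> of its first k coordinates and of the group generated by the tails x, y of alpha, beta;
   this rests on the commutator of beta and its conjugate by alpha^r(n), which is trivial on the
   coordinates after n.  Since r(n) tends to infinity, the conjugates y_l = x^l y x^-l with |l| < K
   commute and have order 3 for k large with respect to K, and G maps onto Q x (Z/3 wr Z).

   Given an almost action, the finite group Q x <y_l : l < K> is first made to act exactly, and x still
   shifts the y_l except at few points.  The Foelner tiles of scale m are the sets O x^i, i < m, for O an
   orbit of <Q, y_l : l < m>.  Points outside orbits of bounded size seldom return to O after less than
   m steps: otherwise O would have too many disjoint translates.  Hence most tiles are embedded copies
   of O x Z/m, on which G acts exactly through Q x (Z/3 wr Z/m).  An Ornstein-Weiss quasi-tiling by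
   tiles of finitely many scales, the largest first, carries the given action to a disjoint union of
   such actions up to few points; the scales depend on epsilon only, not on Q.  On the orbits of
   bounded size, finitely many relators suffice to detect the genuine actions of G. *)

Require Import Defs.
From mathcomp Require Import all_boot all_order all_algebra all_fingroup.
From mathcomp Require Import boolp zify ring Rstruct.
Set Implicit Arguments. Unset Strict Implicit. Unset Printing Implicit Defensive.
Import GroupScope.

(** * Words, lamps and commuting products *)

(** The obstacle is the order of the constants. The cutoff between [Q] and the tails has to exceed
    the width of the windows, so [Q] is known only once the scales are fixed, and no tiling estimate
    that determines the scales may involve [Q]. This is possible because a window orbit grows by
    adjoining commuting elements of order 3, and each of them multiplies its size by at most 3,
    whatever [Q] is. The size of [Q] enters afterwards: in the bound [CQ], in the threshold [B] for
    short orbits, in the relators that control these orbits, and last in the admissible proportion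
    of bad points.

    Short orbits cannot be tiled by long embedded copies, and an action of [G] on them need not
    factor through the lamplighter group. Where the relators hold there, the given action is kept as
    it is.

    The estimates are in natural numbers: [N] is the inverse of the accuracy, and an error [e] is
    small when [N * e] is at most a fixed multiple of [#|T|]. *)

Definition winv (w : word) : word := rev [seq (l.1, ~~ l.2) | l <- w].

Definition wsubst (a b w : word) : word :=
  flatten [seq (let g := if l.1 then b else a in if l.2 then winv g else g)
          | l : letter <- w].

Section Words.
Variable gT : finGroupType.
Implicit Types (a b : gT) (w : word).

Lemma ev_word_cat a b w1 w2 :
  ev_word a b (w1 ++ w2) = ev_word a b w1 * ev_word a b w2.
Proof. by elim: w1 => [|l w1 IH] /=; rewrite ?mul1g // IH mulgA. Qed.

Lemma ev_winv a b w : ev_word a b (winv w) = (ev_word a b w)^-1.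
Proof.
elim: w => [|l w IH]; first by rewrite /winv /= invg1.
rewrite /winv map_cons rev_cons -cats1 ev_word_cat -/(winv w) IH /= invMg mulg1.
by case: (l.2); rewrite ?invgK.
Qed.

Lemma ev_wsubst a b wa wb w :
  ev_word a b (wsubst wa wb w) = ev_word (ev_word a b wa) (ev_word a b wb) w.
Proof.
elim: w => [|l w IH] //=; rewrite /wsubst map_cons /= ev_word_cat.
by rewrite -/(wsubst wa wb w) IH; case: (l.1); case: (l.2); rewrite ?ev_winv.
Qed.

Lemma ev_word_flatten a b (ws : seq word) :
  ev_word a b (flatten ws) = \prod_(w <- ws) ev_word a b w.
Proof. by elim: ws => [|w ws IH]; rewrite ?big_nil // big_cons ev_word_cat IH. Qed.

Lemma ev_word_nseq a b n w :
  ev_word a b (flatten (nseq n w)) = ev_word a b w ^+ n.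
Proof. by elim: n => [|n IH] //=; rewrite ev_word_cat IH expgS. Qed.

Lemma ev_word1 w : ev_word (1 : gT) 1 w = 1.
Proof. by elim: w => [|l w IH] //=; rewrite IH; case: (l.1); case: (l.2); rewrite ?invg1 mulg1. Qed.
End Words.

Section CommutingProducts.
Variables (T : eqType) (gT : finGroupType) (Y : T -> gT).
Hypothesis YC : forall p q, commute (Y p) (Y q).
Hypothesis Y3 : forall q, Y q ^+ 3 = 1.
Implicit Type l : seq (T * nat).

Definition net (q : T) l := sumn [seq p.2 | p <- l & p.1 == q].
Definition prodY l := \prod_(p <- l) Y p.1 ^+ p.2.

Lemma net_cat q l1 l2 : net q (l1 ++ l2) = net q l1 + net q l2.
Proof. by rewrite /net filter_cat map_cat sumn_cat. Qed.

Lemma prodY_cat l1 l2 : prodY (l1 ++ l2) = prodY l1 * prodY l2.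
Proof. by rewrite /prodY big_cat. Qed.

Lemma prodY_extract q l :
  prodY l = Y q ^+ net q l * prodY [seq p <- l | p.1 != q].
Proof.
elim: l => [|p l IH]; first by rewrite /prodY /net !big_nil /= mulg1.
rewrite /prodY big_cons -/(prodY l) IH /net /=.
case: (eqVneq p.1 q) => [->|ne] /=; first by rewrite expgD mulgA.
by rewrite [in RHS]big_cons !mulgA (commuteX2 _ _ (YC p.1 q)).
Qed.

(** Induction on the length: the factors sharing the index of the first one are collected in front,
    where their total exponent is a multiple of 3, so that they cancel. *)
Lemma prodY_eq1 l : (forall q, 3 %| net q l) -> prodY l = 1.
Proof.
have [n] := ubnP (size l); elim: n l => // n IH [|p l]; first by rewrite /prodY big_nil.
move=> lt_n h; rewrite (prodY_extract p.1).
have /dvdnP[k ->] := h p.1; rewrite mulnC expgM Y3 expg1n mul1g; apply: IH.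
  rewrite /= eqxx /= size_filter.
  by apply: leq_ltn_trans (count_size _ _) _; exact: lt_n.
move=> q; rewrite /net -filter_predI.
case: (eqVneq q p.1) => [->|ne].
  rewrite (eq_filter (a2 := pred0)) ?filter_pred0 // => z /=.
  by case: (z.1 == p.1).
rewrite (eq_filter (a2 := fun z => z.1 == q)) ?h // => z /=.
by case: (eqVneq z.1 q) => [->|//]; rewrite ne.
Qed.

(** As all factors have order dividing 3, [l2 ++ l2] serves as the inverse of [l2]. *)
Lemma prodY_eq l1 l2 :
  (forall q, net q l1 = net q l2 %[mod 3]) -> prodY l1 = prodY l2.
Proof.
move=> h; have p3 : prodY (l2 ++ l2 ++ l2) = 1.
  by apply: prodY_eq1 => q; rewrite !net_cat; apply/dvdnP; exists (net q l2); lia.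
have p1 : prodY (l1 ++ l2 ++ l2) = 1.
  apply: prodY_eq1 => q; rewrite !net_cat /dvdn -modnDml h modnDml.
  by rewrite -/(dvdn _ _); apply/dvdnP; exists (net q l2); lia.
by apply: (mulIg (prodY (l2 ++ l2))); rewrite -!prodY_cat p1 p3.
Qed.
End CommutingProducts.

(* The walker of the lamplighter group: x is a step and y turns the lamp at the current position;
   y^-1 is recorded as two turns, since the lamps have order 3. *)
Fixpoint pos (p : int) (w : word) : int :=
  if w is l :: w' then
    pos (if l.1 then p else if l.2 then (p - 1)%R else (p + 1)%R) w'
  else p.

Fixpoint toggles (p : int) (w : word) : seq (int * nat) :=
  if w is l :: w' then
    if l.1 then (p, if l.2 then 2 else 1%N) :: toggles p w'
    else toggles (if l.2 then (p - 1)%R else (p + 1)%R) w'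
  else [::].

(* Membership in the kernel of the map from the free group onto the lamplighter
   group Z/3 wr Z. *)
Definition lamp_trivial (w : word) :=
  forall p : int, pos p w = p /\ forall q, 3 %| net q (toggles p w).

(** Translation invariance of the walk. It reduces every lamp to the lamp at 0, the only one whose
    state the points [lamp_pt] below record. *)
Lemma net_toggles_shift (p q c : int) w :
  net (q + c)%R (toggles (p + c)%R w) = net q (toggles p w).
Proof.
elim: w p => //= -[[] b] w IH p /=.
  by rewrite /net /= (inj_eq (@GRing.addIr _ c)); case: eqP => _ /=; rewrite -/(net _ _) IH.
by rewrite -IH; congr (net _ (toggles _ _)); case: b; lia.
Qed.

(** * The rotation and the 3-cycle *)

Lemma disjoint_support_commute (T : finType) (p q : {perm T}) :
  (forall z, p z = z \/ q z = z) -> commute p q.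
Proof.
move=> h; apply/permP => z; rewrite !permM.
case: (h z) => hz; rewrite hz.
  by case: (h (q z)) => // /perm_inj ->.
by case: (h (p z)) => // /perm_inj ->.
Qed.

Lemma absz_modz_lt m (z : int) : 0 < m -> `|(z %% m)%Z|%N < m.
Proof.
move=> m0; have := modz_ge0 z (d := m) ltac:(lia).
by have := ltz_pmod z (d := m) ltac:(lia); lia.
Qed.

Section Rotation.
Variables (m : nat) (m0 : 0 < m).

(** Points are indexed by integers modulo [m], so that inverse powers of the rotation are plain
    subtractions. *)
Definition rot_pt (z : int) : 'I_m := Ordinal (absz_modz_lt z m0).

Local Notation pt := rot_pt.

Lemma pt_eqP (z z' : int) : pt z = pt z' <-> (m %| (z - z')%R)%Z.
Proof.
rewrite -eqz_mod_dvd; split=> [/(congr1 val) /= h | /eqP h]; last by apply: val_inj; rewrite /= h.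
apply/eqP; have := modz_ge0 z (d := m) ltac:(lia).
by have := modz_ge0 z' (d := m) ltac:(lia); lia.
Qed.

Lemma pt_small (z z' : int) : (`|z - z'| < m)%R -> pt z = pt z' -> z = z'.
Proof.
move=> lt /pt_eqP /dvdzP[k e]; have [k0|k0] := eqVneq k 0%R; first by lia.
by move: lt; rewrite e Num.Theory.normrM; nia.
Qed.

Lemma pt_ord (i : 'I_m) : pt (i : nat) = i.
Proof. by apply: val_inj; rewrite /= modz_nat absz_nat modn_small. Qed.

Lemma alpha_pt z : alpha_perm m (pt z) = pt (z + 1)%R.
Proof.
apply: val_inj; rewrite permE /=.
have e : (`|(z %% m)%Z|%N%:Z = (z %% m)%Z)%R by have := modz_ge0 z (d := m) ltac:(lia); lia.
by rewrite -modzDml -e -PoszD modz_nat addn1 !absz_nat.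
Qed.

Lemma alphaX_pt i z : (alpha_perm m ^+ i) (pt z) = pt (z + i%:Z)%R.
Proof.
elim: i z => [|i IH] z; first by rewrite expg0 perm1; congr pt; lia.
by rewrite expgS permM alpha_pt IH; congr pt; lia.
Qed.

Lemma alphaV_pt z : (alpha_perm m)^-1 (pt z) = pt (z - 1)%R.
Proof. by apply: (@perm_inj _ (alpha_perm m)); rewrite permKV alpha_pt; congr pt; lia. Qed.

Lemma alphaXV_pt i z : (alpha_perm m ^+ i)^-1 (pt z) = pt (z - i%:Z)%R.
Proof. by apply: (@perm_inj _ (alpha_perm m ^+ i)); rewrite permKV alphaX_pt; congr pt; lia. Qed.

Lemma alpha_order : alpha_perm m ^+ m = 1.
Proof.
apply/permP => i; rewrite -(pt_ord i) alphaX_pt perm1; apply/pt_eqP.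
by apply/dvdzP; exists 1%R; lia.
Qed.

End Rotation.

Section Cycles.
Variables (m r : nat).
Hypotheses (m0 : 0 < m) (r0 : 0 < r) (rm : 3 * r <= m).
Local Notation pt := (rot_pt m0).

Lemma beta_perm_def :
  beta_perm m r = tperm (pt 0%R) (pt r) * tperm (pt 0%R) (pt (2 * r)%N).
Proof.
case: m m0 rm => // m' m0' rm'.
have e k : k < m'.+1 -> rot_pt m0' k = inord k.
  by move=> lt; rewrite -{1}(inordK lt) pt_ord.
by rewrite /= -!e //; lia.
Qed.

Lemma pt0_r : pt 0%R != pt r.
Proof. by apply/eqP => /pt_small; lia. Qed.
Lemma pt0_2r : pt 0%R != pt (2 * r)%N.
Proof. by apply/eqP => /pt_small; lia. Qed.
Lemma ptr_2r : pt r != pt (2 * r)%N.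
Proof. by apply/eqP => /pt_small; lia. Qed.

Lemma beta0 : beta_perm m r (pt 0%R) = pt r.
Proof. by rewrite beta_perm_def permM tpermL tpermD // ?pt0_r // eq_sym ptr_2r. Qed.
Lemma beta1 : beta_perm m r (pt r) = pt (2 * r)%N.
Proof. by rewrite beta_perm_def permM tpermR tpermL. Qed.
Lemma beta2 : beta_perm m r (pt (2 * r)%N) = pt 0%R.
Proof. by rewrite beta_perm_def permM [tperm _ (pt r) _]tpermD ?tpermR ?pt0_2r ?ptr_2r. Qed.
Lemma betaD z : z != pt 0%R -> z != pt r -> z != pt (2 * r)%N -> beta_perm m r z = z.
Proof. by move=> *; rewrite beta_perm_def permM !tpermD // eq_sym. Qed.

Lemma beta_order : beta_perm m r ^+ 3 = 1.
Proof.
apply/permP => z; rewrite !expgS expg0 !permM !perm1.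
have [->|n0] := eqVneq z (pt 0%R); first by rewrite beta0 beta1 beta2.
have [->|n1] := eqVneq z (pt r); first by rewrite beta1 beta2 beta0.
have [->|n2] := eqVneq z (pt (2 * r)%N); first by rewrite beta2 beta0 beta1.
by rewrite !(betaD n0 n1 n2).
Qed.

(** The supports are [{0, r, 2r}] and its translate by [-c]. Differences between their points are
    [c] plus a multiple of [r] between [-2r] and [2r]: nonzero, and smaller than [3r <= m] in
    absolute value. *)
Lemma beta_conj_commute c : 0 < c < r ->
  commute (beta_perm m r) (alpha_perm m ^+ c * beta_perm m r * alpha_perm m ^- c).
Proof.
move=> hc; apply: disjoint_support_commute => z.
have [h|h] := boolP [|| z == pt 0%R, z == pt r | z == pt (2 * r)%N]; last first.
  by left; move: h; rewrite !negb_or => /and3P[]; exact: betaD.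
right; rewrite !permM; apply: (@perm_inj _ (alpha_perm m ^+ c)); rewrite permKV.
by case/or3P: h => /eqP ->; rewrite alphaX_pt; apply: betaD; apply/eqP => /pt_small; lia.
Qed.

Lemma beta_conj_commute2 i j : i < r -> j < r ->
  commute (alpha_perm m ^+ i * beta_perm m r * alpha_perm m ^- i)
          (alpha_perm m ^+ j * beta_perm m r * alpha_perm m ^- j).
Proof.
wlog le : i j / i <= j => [H|] hi hj.
  by case: (leqP i j) => [/H|/ltnW /H h]; [exact | exact/commute_sym/h].
have [->|ne] := eqVneq i j; first exact: commute_refl.
set a := alpha_perm m; set b := beta_perm m r.
have eJ n : a ^+ n * b * a ^- n = b ^ (a ^- n) by rewrite /conjg invgK !mulgA.
have := @beta_conj_commute (j - i) ltac:(lia); rewrite -/a -/b !eJ => h.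
have -> : b ^ (a ^- j) = (b ^ (a ^- (j - i))) ^ (a ^- i).
  by rewrite -conjgM -invMg -expgD subnKC.
by rewrite /commute -!conjMg h.
Qed.

(** This point encodes a walker at position [j] and a lamp at 0 in state [c]. While the walker stays
    at distance less than [r] from 0, [beta] moves such a point only when [j] is 0, and then it
    turns the lamp; so the cycle simulates the lamplighter. *)
Definition lamp_pt (j : int) (c : nat) : 'I_m := pt (j + (c %% 3 * r)%N)%R.

Lemma beta_lamp_pt (j : int) c : (`|j| < r)%R ->
  beta_perm m r (lamp_pt j c) = lamp_pt j (if j == 0%R then c.+1 else c).
Proof.
move=> jr; have c3 : c %% 3 < 3 by rewrite ltn_mod.
have [c0|[c1|c2]] : c %% 3 = 0 \/ c %% 3 = 1%N \/ c %% 3 = 2 by lia.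
all: case: eqP => [->|j0]; rewrite /lamp_pt; last first.
1,3,5: rewrite ?c0 ?c1 ?c2; apply: betaD; apply/eqP => /pt_small; lia.
- have -> : c.+1 %% 3 = 1%N by lia.
  by rewrite c0 mul0n mul1n !GRing.add0r; exact: beta0.
- have -> : c.+1 %% 3 = 2 by lia.
  by rewrite c1 mul1n !GRing.add0r; exact: beta1.
have -> : c.+1 %% 3 = 0 by lia.
by rewrite c2 mul0n !GRing.add0r; exact: beta2.
Qed.

Lemma betaV_lamp_pt (j : int) c : (`|j| < r)%R ->
  (beta_perm m r)^-1 (lamp_pt j c) = lamp_pt j (if j == 0%R then c.+2 else c).
Proof.
move=> jr; apply: (@perm_inj _ (beta_perm m r)); rewrite permKV beta_lamp_pt //.
by case: eqP => // _; rewrite /lamp_pt; congr (pt (_ + (_ * _)%N)%R); lia.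
Qed.

Lemma ev_word_lamp_pt w (j : int) c : (`|j| + (size w)%:Z < r)%R ->
  ev_word (alpha_perm m) (beta_perm m r) w (lamp_pt j c) =
  lamp_pt (pos j w) (c + net (0 : int)%R (toggles j w)).
Proof.
elim: w j c => [|[[] b] w IH] j c /= lt; first by rewrite perm1 /net /= addn0.
  rewrite permM /net /=.
  have -> : (if b then (beta_perm m r)^-1 else beta_perm m r) (lamp_pt j c) =
            lamp_pt j (if j == 0%R then c + (if b then 2 else 1%N) else c).
    case: b lt => lt; first by rewrite betaV_lamp_pt ?addn2 //; lia.
    by rewrite beta_lamp_pt ?addn1 //; lia.
  rewrite IH; last by lia.
  by case: (j == 0%R) => //=; rewrite /net addnA.
rewrite permM -IH; last by case: b; lia.
congr (fun_of_perm _ _); rewrite /lamp_pt.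
by case: b {lt}; rewrite ?alphaV_pt ?alpha_pt; congr pt; lia.
Qed.

Lemma pos_bound w (j : int) : (`|pos j w - j| <= (size w)%:Z)%R.
Proof. by elim: w j => [|[[] b] w IH] j /=; [lia | have := IH j; lia | case: b; [have := IH (j - 1)%R | have := IH (j + 1)%R]; lia]. Qed.

Lemma ev_word_eq1_lamp w (j : int) : (`|j| + (size w)%:Z < r)%R ->
  ev_word (alpha_perm m) (beta_perm m r) w = 1 ->
  pos j w = j /\ 3 %| net (0 : int)%R (toggles j w).
Proof.
move=> lt e1; have := ev_word_lamp_pt 0 lt; rewrite e1 perm1 /lamp_pt /dvdn.
set n := net _ _; have := pos_bound w j; set p := pos _ _ => hp.
have n3 : n %% 3 < 3 by rewrite ltn_mod.
rewrite add0n mod0n mul0n => /pt_small e.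
(* The two sides differ by less than [3 * r <= m], so the congruence is an equality. The walk moves
   by less than [r], hence the multiple of [r] is zero. *)
have {}e : (j + 0%N%:Z)%R = (p + (n %% 3 * r)%N%:Z)%R by apply: e; nia.
have n0 : n %% 3 = 0 by nia.
by rewrite n0; split => //; lia.
Qed.
End Cycles.

Lemma in_ker_lamp_trivial (d r : nat -> nat) :
  (forall n, n < r n) -> (forall n, 3 * r n <= d n) ->
  forall w, in_ker (m := d) (fun n => alpha_perm (d n))
              (fun n => beta_perm (d n) (r n)) w -> lamp_trivial w.
Proof.
move=> rn rd w kw p.
have H (j : int) : pos j w = j /\ 3 %| net (0 : int)%R (toggles j w).
  (* Since [n < r n], the walk stays within the range that this coordinate simulates faithfully. *)
  pose n := `|j|%N + size w; have := rn n; have := rd n => h1 h2.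
  by apply: (@ev_word_eq1_lamp (d n) (r n)) => //; lia.
split=> [|q]; first by case: (H p).
have [_] := H (p - q)%R; rewrite -(net_toggles_shift _ 0%R q).
by congr (_ %| net _ (toggles _ _)); lia.
Qed.

(** * Truncation to finitely many coordinates *)

(** These are the relations of the alternating group of degree 4 as a (2,3,3) triangle group:
    [h * g] falls into the Klein four-group, which is the commutator subgroup. *)
Lemma mulg_eq_conj_commg (gT : finGroupType) (g h : gT) :
  g ^+ 3 = 1 -> h ^+ 3 = 1 -> g * h * (g * h) = 1 -> h * g = [~ h, g] ^ g^-1.
Proof.
have sq (k : gT) : k ^+ 3 = 1 -> k * k = k^-1.
  by move=> k3; apply/esym/eqP; rewrite eq_invg_mul -[X in _ == X]k3 !expgS expg0 mulg1.
move=> g3 h3 gh; have i1 : h^-1 * g^-1 = g * h.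
  by rewrite -invMg; apply/eqP; rewrite eq_invg_mul gh.
have -> : [~ h, g] ^ g^-1 = g * (h^-1 * g^-1) * h.
  by rewrite commgEl /conjg invgK !mulgA mulgK.
rewrite i1 -!mulgA (sq h) // mulgA (sq g) // -invMg; apply/esym/eqP.
by rewrite eq_invg_mul; apply/eqP/(mulgI g); rewrite mulg1 !mulgA -[RHS]mul1g -gh !mulgA.
Qed.

(** Used to eliminate the middle term: [g * h] and [h * k] in a normal set put [g * k^-1] in it. *)
Lemma mulgV_conj_cancel (gT : finGroupType) (g h k : gT) :
  g * k^-1 = g * h * ((h * k) ^ k^-1)^-1.
Proof. by rewrite conjgE invgK mulgK invMg !mulgA mulgK. Qed.

Ltac split_ifs := repeat
  match goal with |- context [if ?b then _ else _] =>
    lazymatch b with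
    | context [if _ then _ else _] => fail
    | _ => let H := fresh in case H : b
    end
  end.

(** * One coordinate: the normal closure of a single commutator contains both generators *)

Section Generation.
Variables (m r : nat).
Hypotheses (mP : prime m) (m5 : 5 <= m) (r0 : 0 < r) (rm : 3 * r <= m).
Let m0 : 0 < m. Proof. exact: prime_gt0. Qed.
Let a := alpha_perm m.
Let b := beta_perm m r.

(** Renumbering of the points by multiples of [r], a bijection modulo the prime [m] since
    [0 < r < m]. In it [a ^+ r] is the rotation by one step and [b] is the 3-cycle (0, 1, 2). *)
Let pk (k : int) : 'I_m := rot_pt m0 (k * r%:Z)%R.

Let pk_eqP (k k' : int) : pk k = pk k' <-> (m %| (k - k')%R)%Z.
Proof.
rewrite /pk pt_eqP -GRing.mulrBl Gauss_dvdzl // /coprimez /gcdz eqz_nat !absz_nat.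
by rewrite -/(coprime m r) prime_coprime // gtnNdvd //; lia.
Qed.

Let pk_small (k k' : int) : (`|k - k'| < m)%R -> pk k = pk k' -> k = k'.
Proof.
move=> lt /pk_eqP /dvdzP[q e]; have [q0|q0] := eqVneq q 0%R; first by lia.
by move: lt; rewrite e Num.Theory.normrM; nia.
Qed.

Let b_pk (k : int) : b (pk k) =
  if pk k == pk 0%R then pk 1%R else if pk k == pk 1%R then pk 2%R
  else if pk k == pk 2%R then pk 0%R else pk k.
Proof.
have e0 : pk 0%R = rot_pt m0 0%R by rewrite /pk; congr rot_pt; lia.
have e1 : pk 1%R = rot_pt m0 r by rewrite /pk; congr rot_pt; lia.
have e2 : pk 2%R = rot_pt m0 (2 * r)%N by rewrite /pk; congr rot_pt; lia.
case: eqP => [->|/eqP n0]; first by rewrite e0 e1; exact: beta0.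
case: eqP => [->|/eqP n1]; first by rewrite e1 e2; exact: beta1.
case: eqP => [->|/eqP n2]; first by rewrite e2 e0; exact: beta2.
by apply: betaD; rewrite -?e0 -?e1 -?e2.
Qed.

Let aX_pk (i : nat) (k : int) : (a ^+ (i * r)) (pk k) = pk (k + i)%R.
Proof. by rewrite /pk alphaX_pt; congr rot_pt; lia. Qed.

Let aXV_pk (i : nat) (k : int) : (a ^- (i * r)) (pk k) = pk (k - i%:Z)%R.
Proof. by rewrite /pk alphaXV_pt; congr rot_pt; lia. Qed.

(* The 3-cycle (i r, (i+1) r, (i+2) r). *)
Let c (i : nat) := b ^ (a ^+ (i * r)).

Let cE i (k : int) : c i (pk k) =
  if pk k == pk i then pk (i%:Z + 1)%R else if pk k == pk (i%:Z + 1)%R then pk (i%:Z + 2)%R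
  else if pk k == pk (i%:Z + 2)%R then pk i else pk k.
Proof.
rewrite /c /conjg !permM aXV_pk b_pk.
have E (l : int) : (pk (k - i%:Z)%R == pk l) = (pk k == pk (i%:Z + l)%R).
  by apply/eqP/eqP => /pk_eqP h; apply/pk_eqP; move: h; congr (_ %| _)%Z; lia.
rewrite !E GRing.addr0 (fun_if (a ^+ (i * r))) !(fun_if (fun z => (a ^+ (i * r)) z)) !aX_pk.
by do ?case: ifP => _; congr pk; lia.
Qed.

Let inv_r : exists s : nat, m %| (s * r)%N.-1 /\ 0 < s * r.
Proof.
have cop : coprime r m by rewrite coprime_sym prime_coprime // gtnNdvd //; lia.
case: (egcdnP m r0) => s1 s2 e _; exists s1.
rewrite e (eqP cop) addn1; split=> //=; exact: dvdn_mull.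
Qed.

Let pk_onto z : exists2 k : nat, k < m & z = pk k.
Proof.
have [s [/dvdnP[q sr] s0]] := inv_r.
exists ((z * s) %% m); first by rewrite ltn_mod.
transitivity (rot_pt m0 (z : nat)); first by rewrite pt_ord.
apply/pt_eqP/dvdzP.
have e := divn_eq (z * s) m; set k := _ %% m in e *; set l := _ %/ m in e.
exists (l%:Z * r%:Z - (z : nat)%:Z * q%:Z)%R.
have -> : (k%:Z = (z : nat)%:Z * s%:Z - l%:Z * m%:Z)%R by lia.
have sr' : (s%:Z * r%:Z = q%:Z * m%:Z + 1)%R by lia.
transitivity ((z : nat)%:Z - (z : nat)%:Z * (s%:Z * r%:Z) + l%:Z * m%:Z * r%:Z)%R; first by ring.
by rewrite sr'; ring.
Qed.

Let c_order i : c i ^+ 3 = 1.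
Proof. by rewrite -conjXg beta_order // conj1g. Qed.

Let c0b : c 0 = b. Proof. by rewrite /c mul0n expg0 conjg1. Qed.

Let c_pk (i k : nat) : k < m -> i.+2 < m ->
  c i (pk k) = pk (if k == i then i.+1 else if k == i.+1 then i.+2
                   else if k == i.+2 then i else k).
Proof.
move=> km im; have E (j : nat) : j < m -> (pk k == pk j) = (k == j).
  by move=> jm; apply/eqP/eqP => [/pk_small|-> //]; lia.
have -> : c i (pk k) = if pk k == pk i then pk i.+1 else if pk k == pk i.+1
    then pk i.+2 else if pk k == pk i.+2 then pk i else pk k.
  have e1 : (i%:Z + 1 = i.+1%:Z)%R by lia.
  have e2 : (i%:Z + 2 = i.+2%:Z)%R by lia.
  by rewrite cE e1 e2.
by rewrite !E; try lia; case: eqP => // _; case: eqP => // _; case: eqP.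
Qed.

(** In the new numbering the product of (0, 1, 2) and (1, 2, 3) is (0, 2)(1, 3). *)
Let c_involution : c 0 * c 1 * (c 0 * c 1) = 1.
Proof.
apply/permP => z; have [k km ->] := pk_onto z.
have E w : (c 0 * c 1) w = c 1 (c 0 w) by rewrite permM.
rewrite perm1 permM !E.
have c01 : forall i (k : nat), i < 2 -> k < m -> c i (pk k) = pk (if k == i then i.+1
  else if k == i.+1 then i.+2 else if k == i.+2 then i else k).
  by move=> i k' i2 k'm; apply: c_pk; lia.
have [->|[->|[->|[->|k4]]]] : k = 0 \/ k = 1%N \/ k = 2 \/ k = 3 \/ 3 < k by lia.
1-4: by rewrite !c01 //=; lia.
by rewrite !c01 //= !gtn_eqF //; lia.
Qed.

(** [H] will consist of the values, at one coordinate, of the words that are trivial at all later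
    coordinates. *)
Variable (H : {perm 'I_m} -> Prop).
Hypotheses (H1 : H 1) (HM : forall g h, H g -> H h -> H (g * h))
  (HV : forall g, H g -> H g^-1)
  (HJ : forall w g, H g -> H (g ^ ev_word a b w)).

Let ev_aX n : ev_word a b (nseq n (false, false)) = a ^+ n.
Proof. by elim: n => //= n ->; rewrite expgS. Qed.

Let HJa n g : H g -> H (g ^ (a ^+ n)).
Proof. by rewrite -ev_aX; exact: HJ. Qed.

Let HJb g : H g -> H (g ^ b^-1).
Proof.
have -> : b^-1 = ev_word a b [:: (true, true)] by rewrite /= mulg1.
exact: HJ.
Qed.

Hypothesis Hcomm : H [~ b ^ (a ^+ r), b].

Let Hcc i : H (c i.+1 * c i).
Proof.
have e := mulg_eq_conj_commg (c_order 0) (c_order 1) c_involution.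
have -> : c i.+1 * c i = (c 1 * c 0) ^ (a ^+ (i * r)).
  by rewrite conjMg /c -!conjgM -!expgD mul0n mul1n mulSn addnC.
apply: HJa; rewrite e c0b; apply: HJb.
by rewrite /c mul1n.
Qed.

Let HJb' g : H g -> H (g ^ b).
Proof.
have -> : b = ev_word a b [:: (true, false)] by rewrite /= mulg1.
exact: HJ.
Qed.

(** Modulo [H], each [c i.+1] is the inverse of [c i], so the [c i] are alternately [b] and
    [b^-1]. *)
Let Hc_alt i : H (c i.*2 * b^-1) /\ H (c i.*2.+1 * b).
Proof.
elim: i => [|i [_ IH]].
  rewrite double0 c0b mulgV; split=> //; rewrite -c0b; exact: Hcc.
rewrite doubleS; have e : H (c i.*2.+2 * b^-1).
  rewrite (mulgV_conj_cancel _ (c i.*2.+1)).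
  by apply: HM; [exact: Hcc | apply/HV/HJb].
split=> //; have := mulgV_conj_cancel (c i.*2.+3) (c i.*2.+2) b^-1; rewrite !invgK => ->.
by apply: HM; [exact: Hcc | apply/HV/HJb'].
Qed.

(** The alternation goes once around a cycle of odd length: [c m = b] is also congruent to [b^-1].
    Hence [b * b] is in [H], and so is its square, which is [b]. *)
Lemma beta_mem_normal : H b.
Proof.
have [_] := Hc_alt m./2.
have -> : m./2.*2.+1 = m.
  by have := odd_double_half m; case: (even_prime mP) => [|->]; lia.
have -> : c m = b by rewrite /c expgM alpha_order // expg1n conjg1.
move=> h; have := HM h h; suff -> : b * b * (b * b) = b by apply.
by have := beta_order m0 r0 rm; rewrite -/b !expgS expg0 mulg1 => b3; rewrite -!mulgA b3 mulg1.
Qed.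

Let Hc i : H (c i). Proof. exact/HJa/beta_mem_normal. Qed.

(* [fan t = c (2 t - 2) * ... * c 2 * c 0] is the cycle (0, r, 2 r, ..., 2 t r). *)
Let fan (t : nat) : {perm 'I_m} := iteri t (fun i g => c i.*2 * g) 1.

Let fanS t : fan t.+1 = c t.*2 * fan t. Proof. by []. Qed.

Let fan_pk t (k : nat) : t.*2 < m -> k < m ->
  fan t (pk k) = pk (if k < t.*2 then k.+1 else if k == t.*2 then 0%N else k).
Proof.
elim: t k => [|t IH] k tm km; first by rewrite /fan /= perm1; case: eqP => [->|].
rewrite fanS permM c_pk //.
rewrite IH; try lia; last by split_ifs; lia.
congr pk; congr Posz; split_ifs; lia.
Qed.

(** As [m] is odd, the fan with [m./2] blades passes through all points [0, r, 2r, ...] and equals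
    [a ^+ r]; a power of it is [a], because [r] is invertible modulo [m]. *)
Lemma alpha_mem_normal : H a.
Proof.
have m2 : m = m./2.*2.+1.
  by have := odd_double_half m; case: (even_prime mP) => [|->]; lia.
have fanE : fan m./2 = a ^+ r.
  apply/permP => z; have [k km ->] := pk_onto z.
  rewrite fan_pk //; last by rewrite {2}m2.
  rewrite -[r]mul1n aX_pk; apply/pk_eqP; case: ltnP => [_|ge].
    by apply/dvdzP; exists 0%R; lia.
  have -> : k = m./2.*2 by lia.
  by rewrite eqxx; apply/dvdzP; exists (- 1)%R; lia.
have Hfan t : H (fan t) by elim: t => [|t IH]; [exact: H1 | rewrite fanS; exact: HM].
have HX g n : H g -> H (g ^+ n) by move=> Hg; elim: n => [|n IH]; rewrite ?expg0 // expgS; exact: HM.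
have [s [/dvdnP[q e] s0]] := inv_r.
have <- : (a ^+ r) ^+ s = a.
  rewrite -expgM mulnC -(prednK s0) expgS e mulnC expgM alpha_order //.
  by rewrite expg1n mulg1.
by rewrite -fanE; exact/HX/Hfan.
Qed.
End Generation.

Lemma commute_conjg (gT : finGroupType) (g h k : gT) :
  commute g (h ^ k^-1) -> commute h (g ^ k).
Proof.
move=> e; have := congr1 (conjg^~ k) e.
by rewrite /= (conjMg g) (conjMg (h ^ k^-1)) conjgKV.
Qed.

(** * Splitting off the first coordinates *)

Section Family.
Variables (d r : nat -> nat).
Hypotheses (dP : forall n, prime (d n) /\ 5 <= d n)
  (r_homo : {homo r : m n / m < n}) (r0 : forall n, 0 < r n)
  (rd : forall n, 3 * r n <= d n).

Let al n := alpha_perm (d n).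
Let be n := beta_perm (d n) (r n).
Let ev n w := ev_word (al n) (be n) w.
Let d0 n : 0 < d n. Proof. by have [] := dP n; lia. Qed.

Lemma index_lt_r n : n < r n.
Proof.
elim: n => [|n IH]; first exact: r0.
by have := r_homo (ltnSn n); lia.
Qed.

(** The whole factor generated by [al i] and [be i] lies in the group, supported on coordinate [i]
    alone. *)
Let isolated i := exists wa wb,
  [/\ ev i wa = al i, ev i wb = be i &
      forall n, n != i -> ev n wa = 1 /\ ev n wb = 1].

Let truncate_of k : (forall i, i < k -> isolated i) -> forall w, exists w',
  (forall n, n < k -> ev n w' = ev n w) /\ (forall n, k <= n -> ev n w' = 1).
Proof.
elim: k => [|k IH] iso w; first by exists [::].
have [|w' [lo hi]] := IH _ w; first by move=> i ik; apply: iso; lia.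
have [wa [wb [ea eb e1]]] := iso k (ltnSn k).
have E n : ev n (w' ++ wsubst wa wb w) = ev n w' * ev_word (ev n wa) (ev n wb) w.
  by rewrite /ev ev_word_cat ev_wsubst.
exists (w' ++ wsubst wa wb w); split=> n nk; rewrite E.
  have [->|ne] := eqVneq n k; first by rewrite hi // mul1g ea eb.
  by have [-> ->] := e1 _ ne; rewrite lo ?ev_word1 ?mulg1 //; lia.
by rewrite hi ?mul1g; [have [-> ->] := e1 n ltac:(lia); rewrite ev_word1 | lia].
Qed.

(** Strong induction. The commutator of [be] with its conjugate by [al ^+ r i] dies at every
    coordinate [j > i] because [0 < r i < r j], so the previous section gives words equal to [al i]
    and [be i] at [i] and trivial after [i]. The coordinates before [i] are removed with the
    induction hypothesis. *)
Let isolatedP i : isolated i.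
Proof.
have [n] := ubnP i; elim: n i => // n IH i le_n.
pose H g := exists2 w, ev i w = g & forall j, i < j -> ev j w = 1.
have H1 : H 1 by exists [::].
have HM g h : H g -> H h -> H (g * h).
  move=> [w <- w1] [w' <- w1']; exists (w ++ w'); first by rewrite /ev ev_word_cat.
  by move=> j ij; have := w1 j ij; have := w1' j ij; rewrite /ev ev_word_cat => -> ->; rewrite mulg1.
have HV g : H g -> H g^-1.
  move=> [w <- w1]; exists (winv w); first by rewrite /ev ev_winv.
  by move=> j ij; have := w1 j ij; rewrite /ev ev_winv => ->; rewrite invg1.
have HJ w g : H g -> H (g ^ ev_word (al i) (be i) w).
  move=> [w' <- w1]; exists (winv w ++ w' ++ w).
    by rewrite /ev !ev_word_cat ev_winv.
  move=> j ij; have := w1 j ij; rewrite /ev !ev_word_cat ev_winv => ->.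
  by rewrite mul1g mulVg.
have Hcomm : H [~ be i ^ (al i ^+ r i), be i].
  pose wx := nseq (r i) (false, false).
  pose w1 := winv wx ++ [:: (true, false)] ++ wx.
  pose w2 : word := [:: (true, false)].
  have exx j : ev j wx = al j ^+ r i.
    by rewrite /wx; elim: (r i) => //= k; rewrite /ev /= => ->; rewrite expgS.
  have e1 j : ev j w1 = be j ^ (al j ^+ r i).
    by rewrite /ev !ev_word_cat ev_winv -/(ev j wx) exx /= mulg1.
  have e2 j : ev j w2 = be j by rewrite /ev /= mulg1.
  have ec0 j v1 v2 : ev j (winv v1 ++ winv v2 ++ v1 ++ v2) = [~ ev j v1, ev j v2].
    by rewrite /ev !ev_word_cat !ev_winv /commg /conjg !mulgA.
  have ec j : ev j (winv w1 ++ winv w2 ++ w1 ++ w2) = [~ be j ^ (al j ^+ r i), be j].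
    by rewrite ec0 e1 e2.
  exists (winv w1 ++ winv w2 ++ w1 ++ w2) => [//|j ij]; rewrite ec.
  apply/eqP/commgP/commute_sym.
  have := @beta_conj_commute _ _ (d0 j) (r0 j) (rd j) (r i).
  rewrite r0 r_homo // -/(al j) -/(be j) => /(_ isT).
  have -> : al j ^+ r i * be j * al j ^- r i = be j ^ (al j ^- r i) by rewrite conjgE invgK mulgA.
  exact: commute_conjg.
have [di d5] := dP i.
have [wa ea ha] := alpha_mem_normal di d5 (r0 i) (rd i) H1 HM HV HJ Hcomm.
have [wb eb hb] := beta_mem_normal di d5 (r0 i) (rd i) H1 HM HV HJ Hcomm.
have trunc := @truncate_of i (fun j ji => IH j (leq_trans ji le_n)).
have [ta [la ga]] := trunc wa; have [tb [lb gb]] := trunc wb.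
(* [ta] and [tb] agree with [wa] and [wb] before [i] and are trivial from [i] on, so these quotients
   change only the earlier coordinates. *)
exists (wa ++ winv ta), (wb ++ winv tb).
have E j w w' : ev j (w ++ winv w') = ev j w * (ev j w')^-1.
  by rewrite /ev ev_word_cat ev_winv.
split=> [||j ne]; rewrite !E.
- by rewrite ga // ea invg1 mulg1.
- by rewrite gb // eb invg1 mulg1.
case: (ltngtP j i) ne => // h _; first by rewrite la // lb // !mulgV.
by rewrite ha // hb // ga 1?ltnW // gb 1?ltnW // invg1 mulg1.
Qed.

(* Hence the group is the direct product of its projections to the first [k] coordinates and to
   the other ones. *)
Lemma truncate k w : exists w',
  (forall n, n < k -> ev n w' = ev n w) /\ (forall n, k <= n -> ev n w' = 1).
Proof. by apply: truncate_of => i _; exact: isolatedP. Qed.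
End Family.

(** * Orbits *)

Lemma card_bigcup_le (I T : finType) (A : {set I}) (F : I -> {set T}) n :
  (forall i, i \in A -> #|F i| <= n) -> #|\bigcup_(i in A) F i| <= #|A| * n.
Proof.
move=> H; apply: (@leq_trans (\sum_(i in A) #|F i|)).
  elim/big_rec2: _ => [|i b a _ IH]; first by rewrite cards0.
  by apply: leq_trans (leq_card_setU _ _) _; rewrite leq_add2l.
by rewrite -sum_nat_const; apply: leq_sum.
Qed.

Section Orbits.
Variable T : finType.
Implicit Types (A : {set {perm T}}) (z w : T).

Definition porb A z : {set T} := orbit 'P <<A>> z.

Lemma porb_id A z : z \in porb A z.
Proof. exact: orbit_refl. Qed.

Lemma porb_eq A z w : w \in porb A z -> porb A w = porb A z.
Proof. by move/orbit_eqP. Qed.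

Lemma porb_sym A z w : w \in porb A z -> z \in porb A w.
Proof. by move/porb_eq ->; exact: porb_id. Qed.

Lemma porb_gen A z w g : g \in A -> w \in porb A z -> g w \in porb A z.
Proof. by move=> gA /porb_eq <-; apply: mem_orbit; exact: mem_gen. Qed.

(** In a finite group the generated subgroup consists of positive products, so inverses of
    generators need no case. *)
Lemma porb_ind A z (P : T -> Prop) :
  P z -> (forall g w, g \in A -> w \in porb A z -> P w -> P (g w)) ->
  forall w, w \in porb A z -> P w.
Proof.
move=> Pz PA w /orbitP[g /gen_prodgP[n [c cA ->]] <-].
suff [] : P ((\prod_(i < n) c i) z) /\ (\prod_(i < n) c i) z \in porb A z by [].
elim: n c cA => [|n IH] c cA; first by rewrite big_ord0 perm1; split=> //; exact: porb_id.
rewrite big_ord_recr permM; have [i|Pn zn] := IH (fun i => c (widen_ord (leqnSn n) i)).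
  exact: cA.
by have gA := cA ord_max; split; [apply: PA | apply: porb_gen].
Qed.

Lemma porb_sub A A' z : A \subset A' -> porb A z \subset porb A' z.
Proof.
move=> sA; apply/subsetP => w; apply: (@porb_ind A z (fun w => w \in porb A' z)).
  exact: porb_id.
by move=> g w' gA _; apply: porb_gen; exact: (subsetP sA).
Qed.

Lemma porb_mem_sub A A' z w : A \subset A' -> w \in porb A z -> w \in porb A' z.
Proof. by move=> sA; exact: (subsetP (porb_sub z sA)). Qed.

(** The old orbit and its images under [q] and [q ^+ 2] form an invariant set. The factor 3 does not
    depend on [A], which is what makes the scales independent of [Q]. *)
Lemma porb_adjoin_card A A' q z :
  (forall g, g \in A -> commute g q) -> q ^+ 3 = 1 -> A' \subset q |: A ->
  #|porb A' z| <= 3 * #|porb A z|.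
Proof.
move=> cq q3 sA.
have sub : porb A' z \subset [set (q ^+ (p : 'I_3 * T).1) p.2 | p in setX [set: 'I_3] (porb A z)].
  apply/subsetP; apply: (@porb_ind A' z (fun w => w \in [set _ | _ in _])).
    by apply/imsetP; exists (ord0, z); rewrite ?inE ?porb_id //= expg0 perm1.
  move=> g w /(subsetP sA); rewrite !inE => gA _ /imsetP[[i o]].
  rewrite !inE /= => oz ->; case/orP: gA => [/eqP ->|gA].
    apply/imsetP; exists (inord (i.+1 %% 3), o); rewrite ?inE //= inordK ?ltn_mod //.
    rewrite -permM -expgSr; congr (fun_of_perm _ o).
    by rewrite {1}(divn_eq i.+1 3) expgD mulnC expgM q3 expg1n mul1g.
  apply/imsetP; exists (i, g o); rewrite ?inE //= ?porb_gen //.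
  by rewrite -!permM (commuteX _ (cq g gA)).
apply: leq_trans (subset_leq_card sub) _; apply: leq_trans (leq_imset_card _ _) _.
by rewrite cardsX cardsT card_ord.
Qed.

(** From local to global: an invariant set is partitioned into orbits, and the inequality is summed
    over them. *)
Lemma leq_sum_porb A (S : {set T}) (a b : T -> nat) :
  (forall g z, g \in A -> z \in S -> g z \in S) ->
  (forall z, z \in S -> \sum_(w in porb A z) a w <= \sum_(w in porb A z) b w) ->
  \sum_(w in S) a w <= \sum_(w in S) b w.
Proof.
move=> SA ab.
have part (f : T -> nat) : \sum_(w in S) f w =
    \sum_(O in [set porb A z | z in S]) \sum_(w in S | porb A w == O) f w.
  by apply: partition_big => w wS; apply: imset_f.
rewrite !part; apply: leq_sum => _ /imsetP[z zS ->].
have E (f : T -> nat) : \sum_(w in S | porb A w == porb A z) f w =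
    \sum_(w in porb A z) f w.
  apply: eq_bigl => w; apply/andP/idP => [[_ /eqP <-]|wz]; first exact: porb_id.
  split; last by apply/eqP/porb_eq.
  by apply: (@porb_ind A z (fun w => w \in S)) wz => // g w' gA _; exact: SA.
by rewrite !E; exact: ab.
Qed.
End Orbits.

(** * Partial models of an almost action *)

Lemma ev_word_morph_in (D E : finType) (C : {set D}) (h : D -> E)
    (a b : {perm D}) (a' b' : {perm E}) w :
  (forall c, (a c \in C) = (c \in C)) -> (forall c, (b c \in C) = (c \in C)) ->
  (forall c, c \in C -> a' (h c) = h (a c)) -> (forall c, c \in C -> b' (h c) = h (b c)) ->
  forall c, c \in C -> ev_word a' b' w (h c) = h (ev_word a b w c).
Proof.
move=> aC bC ah bh; elim: w => [|[i j] w IH] c cC /=; first by rewrite !perm1.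
have inv (p : {perm D}) (p' : {perm E}) :
    (forall c, (p c \in C) = (c \in C)) -> (forall c, c \in C -> p' (h c) = h (p c)) ->
    (if j then p'^-1 else p') (h c) = h ((if j then p^-1 else p) c) /\
    (if j then p^-1 else p) c \in C.
  move=> pC ph; case: j; last by rewrite ph // pC.
  have cC' : p^-1 c \in C by rewrite -pC permKV.
  by split=> //; apply: (@perm_inj _ p'); rewrite permKV ph // permKV.
by rewrite !permM; case: i; [have [-> C'] := inv b b' bC bh | have [-> C'] := inv a a' aC ah];
  rewrite IH.
Qed.

Lemma transfer_perm (D E : finType) (C : {set D}) (F : D -> E) (p : {perm D}) :
  {in C &, injective F} -> (forall c, (p c \in C) = (c \in C)) ->
  exists q : {perm E}, (forall c, c \in C -> q (F c) = F (p c)) /\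
    (forall z, z \notin F @: C -> q z = z).
Proof.
move=> Finj pC.
pose h z := if [pick c in C | F c == z] is Some c then F (p c) else z.
have hF c : c \in C -> h (F c) = F (p c).
  move=> cC; rewrite /h; case: pickP => [c' /andP[c'C /eqP e]|/(_ c)]; last by rewrite cC eqxx.
  by rewrite (Finj _ _ c'C cC e).
have hN z : z \notin F @: C -> h z = z.
  rewrite /h; case: pickP => // c /andP[cC /eqP <-].
  by rewrite imset_f.
have hinj : injective h.
  move=> z z'; case: (boolP (z \in F @: C)) => [/imsetP[c cC ->]|zN];
    case: (boolP (z' \in F @: C)) => [/imsetP[c' cC' ->]|zN'].
  - by rewrite !hF // => /Finj; rewrite !pC => /(_ cC cC') /perm_inj ->.
  - by rewrite hF // hN // => e; move: zN'; rewrite -e imset_f // pC.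
  - by rewrite hN // hF // => e; move: zN; rewrite e imset_f // pC.
  by rewrite !hN.
by exists (perm hinj); split=> z zC; rewrite permE; [exact: hF | exact: hN].
Qed.

(** The rest of [C] is matched with the complement of [f @: V] in the order of their enumerations;
    the cardinalities leave enough room. *)
Lemma extend_injection (D E : finType) (C V : {set D}) (f : D -> E) :
  V \subset C -> {in V &, injective f} -> #|C| <= #|E| ->
  exists F : D -> E, {in C &, injective F} /\ {in V, F =1 f}.
Proof.
move=> VC finj CE; pose A := C :\: V; pose A' := ~: (f @: V).
have AA' : #|A| <= #|A'|.
  have := cardsC (f @: V); rewrite card_in_imset // => e.
  by have := cardsD C V; rewrite (setIidPr VC) -/A -/A' in e *; lia.
pose g c := nth (f c) (enum A') (index c (enum A)).
have ltA c : c \in A -> index c (enum A) < size (enum A').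
  by move=> cA; rewrite -cardE; apply: leq_trans AA'; rewrite cardE index_mem mem_enum.
have gA c : c \in A -> g c \in A' by move=> /ltA lt; rewrite -mem_enum; exact: mem_nth.
have ginj : {in A &, injective g}.
  move=> c c' cA c'A; rewrite /g (set_nth_default (f c')) ?ltA // => /eqP.
  rewrite nth_uniq ?ltA ?enum_uniq // => /eqP e.
  by rewrite -[c](nth_index c (s := enum A)) ?mem_enum // e nth_index // mem_enum.
exists (fun c => if c \in V then f c else g c); split; last by move=> c /= ->.
move=> c c' cC c'C; case: ifP => cV; case: ifP => c'V.
- exact: finj.
- have cA : c' \in A by rewrite inE c'V.
  by move=> e; have := gA _ cA; rewrite -e inE imset_f.
- have cA : c \in A by rewrite inE cV.
  by move=> e; have := gA _ cA; rewrite e inE imset_f.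
by apply: ginj; rewrite inE ?cV ?c'V.
Qed.

Definition diff (T : finType) (p q : {perm T}) := #|[set z | p z != q z]|.

Section Models.
Variables (Ker : word -> Prop) (T : finType) (s t : {perm T}) (N : nat).

(* [D] with [sD, tD] is a genuine action of the target group on the invariant set [C]; the
   partial injection [f] from [V] carries it to [s, t] except at at most [4 #|C| / N] points. *)
Definition model (Y : {set T}) (n : nat) : Prop :=
  exists (D : finType) (sD tD : {perm D}) (C V : {set D}) (f : D -> T),
  [/\ (forall w c, Ker w -> c \in C -> ev_word sD tD w c = c),
      (forall c, (sD c \in C) = (c \in C)) /\ (forall c, (tD c \in C) = (c \in C)),
      #|C| = n,
      [/\ V \subset C, {in V &, injective f} & forall c, c \in V -> f c \in Y] &
      N * #|[set c in C | ~~ [&& c \in V, sD c \in V, tD c \in V,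
           f (sD c) == s (f c) & f (tD c) == t (f c)]]| <= 4 * n].

Lemma model_init (G0 : {set T}) :
  (forall z, (s z \in G0) = (z \in G0)) -> (forall z, (t z \in G0) = (z \in G0)) ->
  (forall w z, Ker w -> z \in G0 -> ev_word s t w z = z) -> model G0 #|G0|.
Proof.
move=> sG tG K; exists T, s, t, G0, G0, id; split=> //; first by split.
rewrite (_ : [set c in G0 | _] = set0) ?cards0 ?muln0 //.
by apply/setP => z; rewrite !inE sG tG !eqxx !andbT; case: (z \in G0).
Qed.

(** The second hypothesis is [model (Y' :\: Y) n'] unfolded. Removing [Y] makes the two partial
    injections disjoint, so the model lives on the disjoint sum; overlaps of tiles are thus paid for
    in points lost from [V]. *)
Lemma model_add Y Y' (n n' : nat) :
  model Y n -> (exists (D : finType) (sD tD : {perm D}) (C V : {set D}) (f : D -> T),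
  [/\ (forall w c, Ker w -> c \in C -> ev_word sD tD w c = c),
      (forall c, (sD c \in C) = (c \in C)) /\ (forall c, (tD c \in C) = (c \in C)),
      #|C| = n',
      [/\ V \subset C, {in V &, injective f} & forall c, c \in V -> f c \in Y' :\: Y] &
      N * #|[set c in C | ~~ [&& c \in V, sD c \in V, tD c \in V,
           f (sD c) == s (f c) & f (tD c) == t (f c)]]| <= 4 * n']) ->
  model (Y' :|: Y) (n' + n).
Proof.
move=> [D [sD [tD [C [V [f [K1 [sC tC] cC [VC finj fY] b1]]]]]]].
move=> [D' [sD' [tD' [C' [V' [f' [K1' [sC' tC'] cC' [VC' finj' fY'] b1']]]]]]].
pose sumf (p : {perm D}) (p' : {perm D'}) (c : D + D') :=
  match c with inl c => inl (p c) | inr c => inr (p' c) end.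
have sum_inj p p' : injective (sumf p p').
  by move=> [c|c] [e|e] //= [] /perm_inj ->.
pose sum_set (A : {set D}) (A' : {set D'}) :=
  [set c : D + D' | match c with inl c => c \in A | inr c => c \in A' end].
have card_sum A A' : #|sum_set A A'| = (#|A'| + #|A|)%N.
  have -> : sum_set A A' = inl @: A :|: inr @: A'.
    apply/setP => -[c|c]; rewrite !inE.
      rewrite (mem_imset _ _ (@inl_inj _ _)); case: (c \in A) => //=.
      by apply/esym/imsetP => -[].
    rewrite (mem_imset _ _ (@inr_inj _ _)) orbC; case: (c \in A') => //=.
    by apply/esym/imsetP => -[].
  rewrite cardsU !card_imset; [|exact: inr_inj|exact: inl_inj].
  rewrite (_ : inl @: A :&: inr @: A' = set0) ?cards0 ?subn0 1?addnC //.
  by apply/setP => c; rewrite !inE; apply/andP => -[/imsetP[? _ ->] /imsetP[]].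
exists (D + D')%type, (perm (sum_inj sD sD')), (perm (sum_inj tD tD')), (sum_set C C'),
  (sum_set V V'), (fun c => match c with inl c => f c | inr c => f' c end); split.
- have L w c : ev_word (perm (sum_inj sD sD')) (perm (sum_inj tD tD')) w (inl c) =
    inl (ev_word sD tD w c).
    apply: (@ev_word_morph_in _ _ [set: D] (fun c => inl c)) => //; try by move=> ?; rewrite !inE.
    - by move=> e _; rewrite permE.
    - by move=> e _; rewrite permE.
  have R w c : ev_word (perm (sum_inj sD sD')) (perm (sum_inj tD tD')) w (inr c) =
    inr (ev_word sD' tD' w c).
    apply: (@ev_word_morph_in _ _ [set: D'] (fun c => inr c)) => //; try by move=> ?; rewrite !inE.
    - by move=> e _; rewrite permE.
    - by move=> e _; rewrite permE.
  by move=> w [c|c] Kw; rewrite !inE => cin; rewrite ?L ?R ?K1 ?K1'.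
- by split=> -[c|c]; rewrite permE !in_set /= ?sC ?tC ?sC' ?tC'.
- by rewrite card_sum cC cC'.
- split.
  + apply/subsetP => -[c|c]; rewrite !inE; first exact: (subsetP VC).
    exact: (subsetP VC').
  + move=> [c|c] [e|e]; rewrite !inE => cV eV h.
    * by rewrite (finj _ _ cV eV h).
    * by have := fY' _ eV; rewrite -h inE fY.
    * by have := fY' _ cV; rewrite h inE fY.
    by rewrite (finj' _ _ cV eV h).
  by move=> [c|c]; rewrite !inE => cV; [rewrite fY ?orbT | have := fY' _ cV; rewrite inE => /andP[_ ->]].
set bad := [set c in C | _] in b1; set bad' := [set c in C' | _] in b1'.
set badS := [set c in _ | _].
have -> : badS = sum_set bad bad'.
  by apply/setP => -[c|c]; rewrite !inE !permE /=.
by rewrite card_sum !mulnDr leq_add.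
Qed.

(** The model is embedded in [T] along an extension of [f], and the generators act trivially
    elsewhere, which is an action of any group. The error 5 is the 4 of the model plus 1 for the
    points outside its image. *)
Lemma model_transfer Y n : model Y n -> n <= #|T| -> N * (#|T| - n) <= #|T| ->
  exists s' t' : {perm T}, [/\ forall w, Ker w -> ev_word s' t' w = 1,
    N * diff s s' <= 5 * #|T| & N * diff t t' <= 5 * #|T| ].
Proof.
move=> [D [sD [tD [C [V [f [K1 [sC tC] cC [VC finj fY] b1]]]]]]] nT nN.
have [F [Finj FV]] := extend_injection VC finj (leq_trans (eq_leq cC) nT).
have [s' [sF s1]] := transfer_perm Finj sC; have [t' [tF t1]] := transfer_perm Finj tC.
set bad := [set c in C | _] in b1; pose nice := C :\: bad.
have niceP c : c \in nice -> [/\ c \in C, s (F c) = s' (F c) & t (F c) = t' (F c)].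
  rewrite !inE negb_and => /andP[/orP[/negPf->//|]]; rewrite negbK.
  case/and5P=> cV sV tV /eqP es /eqP et cin; split=> //.
    by rewrite sF // FV // (FV _ sV) es.
  by rewrite tF // FV // (FV _ tV) et.
have bC : bad \subset C by apply/subsetP => c; rewrite inE => /andP[].
have card_nice : (#|nice| + #|bad|)%N = n.
  by rewrite /nice cardsD (setIidPr bC) subnK // subset_leq_card.
have FN : #|F @: nice| = #|nice|.
  by apply: card_in_imset => c c' /niceP[cC' _ _] /niceP[c'C _ _]; exact: Finj.
have bound (p q : {perm T}) : (forall c, c \in nice -> p (F c) = q (F c)) ->
    N * diff p q <= 5 * #|T|.
  move=> pq; have sub : [set z | p z != q z] \subset ~: (F @: nice).
    apply/subsetP => z; rewrite !inE; apply: contraNN => /imsetP[c cn ->].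
    by rewrite pq.
  have := subset_leq_card sub; have := cardsC (F @: nice); rewrite FN -/(diff p q).
  move: (#|~: _|) => k e le; apply: leq_trans (leq_mul (leqnn N) le) _.
  have -> : k = (#|T| - n + #|bad|)%N by move: e nT card_nice; clear; lia.
  by rewrite mulnDr; move: nN b1 nT; clear; lia.
exists s', t'; split; last first.
- by apply: bound => c /niceP[].
- by apply: bound => c /niceP[].
move=> w Kw; apply/permP => z; rewrite perm1.
have [/imsetP[c cin ->]|zN] := boolP (z \in F @: C).
  by rewrite (@ev_word_morph_in _ _ C F sD tD) // K1.
elim: w {Kw} => [|[i j] w IH] /=; first by rewrite perm1.
rewrite permM.
have fixV (p : {perm T}) : p z = z -> p^-1 z = z.
  by move=> e; apply: (@perm_inj _ p); rewrite permKV.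
by have -> : (if j then (if i then t' else s')^-1 else if i then t' else s') z = z
  by case: i; case: j; rewrite ?fixV ?s1 ?t1.
Qed.
End Models.

(* The action, on [m] copies of [T] arranged in a circle, in which the first generator moves every
   point to the next level and the second one acts by [y i] on level [i]. *)
Section Tower.
Variables (T : finType) (u v : {perm T}) (y : nat -> {perm T}) (m : nat).
Hypotheses (yC : forall i j, i < m -> j < m -> commute (y i) (y j))
  (y3 : forall i, i < m -> y i ^+ 3 = 1)
  (uy : forall i, i < m -> commute u (y i)) (vy : forall i, i < m -> commute v (y i)).

Lemma tower_s_inj : injective (fun p : T * 'I_m => (u p.1, alpha_perm m p.2)).
Proof. by move=> [z i] [z' i'] /= [] /perm_inj -> /perm_inj ->. Qed.

Lemma tower_t_inj : injective (fun p : T * 'I_m => (y p.2 (v p.1), p.2)).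
Proof. by move=> [z i] [z' i'] /= [] + e; rewrite e => /perm_inj /perm_inj ->. Qed.

Definition tower_s := perm tower_s_inj.
Definition tower_t := perm tower_t_inj.

(** A word acts on the base through [u], [v] and through the lamps at the visited levels, and on the
    levels through the position. Levels are read modulo [m], which is harmless: each lamp already
    has total exponent divisible by 3 before reduction. *)
Lemma tower_lamp_trivial w : lamp_trivial w -> ev_word u v w = 1 ->
  ev_word tower_s tower_t w = 1.
Proof.
move=> lw uvw; apply/permP => -[z i]; rewrite perm1.
have m0 : 0 < m by apply: leq_ltn_trans (ltn_ord i).
pose Y (q : int) := y (rot_pt m0 q).
have YC p q : commute (Y p) (Y q) by apply: yC; exact: ltn_ord.
have Y3 q : Y q ^+ 3 = 1 by apply: y3; exact: ltn_ord.
have evY w' q : commute (ev_word u v w') (Y q).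
  elim: w' => [|[k j] w' IH] /=; first exact/commute_sym/commute1.
  apply/commute_sym/commuteM; last exact/commute_sym.
  have uY : commute (Y q) u by apply/commute_sym/uy/ltn_ord.
  have vY : commute (Y q) v by apply/commute_sym/vy/ltn_ord.
  by case: k; case: j => //; apply: commuteV.
have main w' (p : int) z' : ev_word tower_s tower_t w' (z', rot_pt m0 p) =
    (prodY Y (toggles p w') (ev_word u v w' z'), rot_pt m0 (pos p w')).
  elim: w' p z' => [|[k j] w' IH] p z' /=.
    by rewrite !perm1 /prodY big_nil perm1.
  rewrite !permM; case: k => /=; last first.
    have -> : (if j then tower_s^-1 else tower_s) (z', rot_pt m0 p) =
        ((if j then u^-1 else u) z', rot_pt m0 (if j then (p - 1)%R else (p + 1)%R)).
      case: j; last by rewrite permE /= alpha_pt.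
      apply: (@perm_inj _ tower_s); rewrite permKV permE /= permKV alpha_pt.
      by congr (_, rot_pt _ _); lia.
    by rewrite IH; case: j.
  have -> : (if j then tower_t^-1 else tower_t) (z', rot_pt m0 p) =
      ((Y p ^+ (if j then 2 else 1%N)) ((if j then v^-1 else v) z'), rot_pt m0 p).
    case: j; last by rewrite permE /= expg1.
    apply: (@perm_inj _ tower_t); rewrite permKV permE /=; congr (_, _).
    have cv : commute (Y p ^+ 2) v by apply/commute_sym/commuteX/vy/ltn_ord.
    rewrite -[v _](permM _ v) -[_ ((_ * v) _)](permM _ (Y p)) cv.
    by rewrite -mulgA -expgSr Y3 mulg1 permKV.
  rewrite IH /prodY big_cons -/(prodY Y _) permM.
  rewrite -(permM (Y p ^+ _) (ev_word u v w')) -(commuteX _ (evY w' p)) permM.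
  by case: j.
have -> : i = rot_pt m0 (Posz i) by rewrite pt_ord.
rewrite main; have [-> net0] := lw (Posz i).
by rewrite prodY_eq1 // uvw !perm1.
Qed.
End Tower.

(** * Quasi-tilings *)

(** The ratio is dictated by the boundary estimate: the points whose tile of scale [m] crosses the
    edge of a tile of scale [M] are at most a proportion [2 * m * 3 ^ m / M] of that tile, which is
    at most [1 / (8 N)] for [M] at least the next scale. *)
Fixpoint scale (N i : nat) : nat :=
  if i is j.+1 then (16 * N * scale N j * 3 ^ scale N j)%N else N.

Lemma leq_scale_step N n : 0 < N -> n <= 16 * N * n * 3 ^ n.
Proof.
move=> N0; have -> : (16 * N * n * 3 ^ n)%N = (n * (16 * N * 3 ^ n))%N.
  by move: (3 ^ n)%N; lia.
by rewrite leq_pmulr // !muln_gt0 N0 expn_gt0.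
Qed.

Section Windows.
Variables (T : finType) (u v x : {perm T}) (y : nat -> {perm T}) (K : nat).
Hypotheses (yC : forall i j, i < K -> j < K -> commute (y i) (y j))
  (y3 : forall i, i < K -> y i ^+ 3 = 1)
  (uy : forall i, i < K -> commute u (y i))
  (vy : forall i, i < K -> commute v (y i)).

Definition window lo hi : {set {perm T}} :=
  [set g in u :: v :: [seq y l | l <- iota lo (hi - lo)]].

Lemma windowP lo hi g :
  reflect [\/ g = u, g = v | exists2 l, lo <= l < hi & g = y l] (g \in window lo hi).
Proof.
rewrite inE !in_cons; apply: (iffP or3P).
  case=> [/eqP ->|/eqP ->|/mapP[l]]; [exact: Or31 | exact: Or32|].
  by rewrite mem_iota => lt ->; apply: Or33; exists l => //; lia.
case=> [->|->|[l lt ->]]; [by apply: Or31 | by apply: Or32|].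
by apply: Or33; apply: map_f; rewrite mem_iota; lia.
Qed.

Lemma window_u lo hi : u \in window lo hi. Proof. by apply/windowP; apply: Or31. Qed.
Lemma window_v lo hi : v \in window lo hi. Proof. by apply/windowP; apply: Or32. Qed.
Lemma window_y lo hi l : lo <= l < hi -> y l \in window lo hi.
Proof. by move=> lt; apply/windowP; apply: Or33; exists l. Qed.

Lemma window_sub lo hi lo' hi' :
  lo' <= lo -> hi <= hi' -> window lo hi \subset window lo' hi'.
Proof.
move=> l1 l2; apply/subsetP => g /windowP[->|->|[l lt ->]].
- exact: window_u.
- exact: window_v.
by apply: window_y; lia.
Qed.

Local Notation orb lo hi := (porb (window lo hi)).

Lemma orb_sub lo hi lo' hi' z w :
  lo' <= lo -> hi <= hi' -> w \in orb lo hi z -> w \in orb lo' hi' z.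
Proof. by move=> l1 l2; apply/porb_mem_sub/window_sub. Qed.

Lemma window_yC lo hi g l : hi <= K -> l < K -> g \in window lo hi -> commute g (y l).
Proof.
move=> hK lK /windowP[->|->|[i lt ->]]; [exact: uy | exact: vy|].
by apply: yC => //; lia.
Qed.

(** An element of the full window either belongs to the smaller window or is a lamp commuting with
    it, so it permutes the orbits of the smaller window. The case split is needed since [u] and [v]
    need not commute. *)
Lemma orb_comm lo hi g z w : hi <= K -> g \in window 0 K ->
  w \in orb lo hi z -> g w \in orb lo hi (g z).
Proof.
move=> hK gK; case: (boolP (g \in window lo hi)) => [gA|gA].
  move=> wz; rewrite (porb_eq (porb_gen gA (porb_id _ z))); exact: porb_gen.
have [l lK ->] : exists2 l, l < K & g = y l.
  by case/windowP: gK gA => [->|->|[l lt ->]]; rewrite ?window_u ?window_v // => _; exists l.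
apply: (@porb_ind _ _ z (fun w => y l w \in orb lo hi (y l z))); first exact: porb_id.
move=> h w' hA _ IH; rewrite -permM (window_yC hK lK hA) permM; exact: porb_gen.
Qed.

(** Whether [y l] preserves a window orbit is constant along the orbit of the full window, as [y l]
    commutes with that whole window. *)
Lemma orb_stab_transport lo hi l z w : hi <= K -> l < K -> w \in orb 0 K z ->
  y l z \in orb lo hi z -> y l w \in orb lo hi w.
Proof.
move=> hK lK + yz; apply: (@porb_ind _ _ z (fun w => y l w \in orb lo hi w)) => //.
move=> h w' hA _ IH; rewrite -permM (window_yC (leqnn K) lK hA) permM.
exact: orb_comm.
Qed.

Lemma card_orb_low lo hi c z : hi <= K -> lo <= K ->
  #|orb (lo - c) hi z| <= 3 ^ c * #|orb lo hi z|.
Proof.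
move=> hK lK; elim: c => [|c IH]; first by rewrite subn0 expn0 mul1n.
case: (leqP lo c) => [le|lt].
  have -> : lo - c.+1 = lo - c by lia.
  apply: leq_trans IH _.
  by rewrite leq_mul2r leq_exp2l // leqnSn orbT.
rewrite expnS -mulnA; apply: (@leq_trans (3 * #|orb (lo - c) hi z|)); last first.
  by rewrite leq_mul2l IH.
apply: (@porb_adjoin_card _ _ _ (y (lo - c.+1))).
- by move=> g; apply: window_yC => //; lia.
- by apply: y3; lia.
apply/subsetP => g /windowP[->|->|[l lt' ->]]; rewrite in_setU1.
- by rewrite window_u orbT.
- by rewrite window_v orbT.
by case: (eqVneq l (lo - c.+1)) => [->|ne]; rewrite ?eqxx // window_y ?orbT //; lia.
Qed.

Lemma card_orb_high lo hi c z : hi + c <= K ->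
  #|orb lo (hi + c) z| <= 3 ^ c * #|orb lo hi z|.
Proof.
elim: c => [|c IH] hK; first by rewrite addn0 expn0 mul1n.
rewrite expnS -mulnA; apply: (@leq_trans (3 * #|orb lo (hi + c) z|)); last first.
  by rewrite leq_mul2l IH //; lia.
apply: (@porb_adjoin_card _ _ _ (y (hi + c))).
- by move=> g; apply: window_yC => //; lia.
- by apply: y3; lia.
apply/subsetP => g /windowP[->|->|[l lt' ->]]; rewrite in_setU1.
- by rewrite window_u orbT.
- by rewrite window_v orbT.
by case: (eqVneq l (hi + c)) => [->|ne]; rewrite ?eqxx // window_y ?orbT //; lia.
Qed.

(* On all of [T] the window relations are exact; [X] is the set of points near which [x] shifts
   the window as it should, up to distance [K]. *)
Variable X : {set T}.
Hypotheses (XG : forall g z, g \in window 0 K -> z \in X -> g z \in X)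
  (xy : forall z l j, z \in X -> l + j < K -> y l ((x ^+ j) z) = (x ^+ j) (y (l + j) z))
  (xu : forall z j, z \in X -> j <= K -> u ((x ^+ j) z) = (x ^+ j) (u z))
  (xv : forall z j, z \in X -> j <= K -> v ((x ^+ j) z) = (x ^+ j) (v z))
  (xVy : forall z l j, z \in X -> l + j < K -> y (l + j) ((x ^- j) z) = (x ^- j) (y l z))
  (xVu : forall z j, z \in X -> j <= K -> u ((x ^- j) z) = (x ^- j) (u z))
  (xVv : forall z j, z \in X -> j <= K -> v ((x ^- j) z) = (x ^- j) (v z)).

Lemma orb_X lo hi z w : hi <= K -> z \in X -> w \in orb lo hi z -> w \in X.
Proof.
move=> hK zX; apply: (@porb_ind _ _ z (fun w => w \in X)) => // g w' gA _.
by apply: XG; apply: (subsetP (window_sub (leq0n lo) hK)).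
Qed.

Lemma orb_shift lo hi j z w : z \in X -> hi + j <= K ->
  w \in orb lo hi ((x ^+ j) z) ->
  exists2 w', w' \in orb (lo + j) (hi + j) z & w = (x ^+ j) w'.
Proof.
move=> zX hK; apply: (@porb_ind _ _ _ (fun w => exists2 w',
   w' \in orb (lo + j) (hi + j) z & w = (x ^+ j) w')).
  by exists z => //; exact: porb_id.
move=> g _ gA _ [w' wz ->]; have wX := orb_X hK zX wz.
case/windowP: gA => [->|->|[l lt ->]].
- by exists (u w'); [apply: porb_gen => //; exact: window_u | rewrite xu //; lia].
- by exists (v w'); [apply: porb_gen => //; exact: window_v | rewrite xv //; lia].
exists (y (l + j) w'); last by rewrite xy //; lia.
by apply: porb_gen => //; apply: window_y; lia.
Qed.

Lemma orb_unshift lo hi j z w : z \in X -> hi + j <= K ->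
  w \in orb lo hi z -> (x ^- j) w \in orb (lo + j) (hi + j) ((x ^- j) z).
Proof.
move=> zX hK; apply: (@porb_ind _ _ z (fun w =>
   (x ^- j) w \in orb (lo + j) (hi + j) ((x ^- j) z))); first exact: porb_id.
move=> g w' gA wz IH; have wX := orb_X (leq_trans (leq_addr j hi) hK) zX wz.
case/windowP: gA => [->|->|[l lt ->]].
- by rewrite -xVu //; [apply: porb_gen => //; exact: window_u | lia].
- by rewrite -xVv //; [apply: porb_gen => //; exact: window_v | lia].
by rewrite -xVy //; [apply: porb_gen => //; apply: window_y | ]; lia.
Qed.

Lemma orb_unshift_inv lo hi j z w : z \in X -> hi + j <= K ->
  w \in orb (lo + j) (hi + j) ((x ^- j) z) ->
  exists2 w', w' \in orb lo hi z & w = (x ^- j) w'.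
Proof.
move=> zX hK; apply: (@porb_ind _ _ _ (fun w => exists2 w',
   w' \in orb lo hi z & w = (x ^- j) w')).
  by exists z => //; exact: porb_id.
move=> g _ gA _ [w' wz ->]; have wX := orb_X (leq_trans (leq_addr j hi) hK) zX wz.
case/windowP: gA => [->|->|[l lt ->]].
- by exists (u w'); [apply: porb_gen => //; exact: window_u | rewrite xVu //; lia].
- by exists (v w'); [apply: porb_gen => //; exact: window_v | rewrite xVv //; lia].
exists (y (l - j) w'); first by apply: porb_gen => //; apply: window_y; lia.
by rewrite -xVy // ?subnK //; lia.
Qed.

Definition ambient : {set {perm T}} := [set u; v; x; y 0].
Local Notation gorb := (porb ambient).

Lemma ambient_u : u \in ambient. Proof. by rewrite !inE eqxx. Qed.
Lemma ambient_v : v \in ambient. Proof. by rewrite !inE eqxx !orbT. Qed.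
Lemma ambient_x : x \in ambient. Proof. by rewrite !inE eqxx !orbT. Qed.
Lemma ambient_y : y 0 \in ambient. Proof. by rewrite !inE eqxx !orbT. Qed.

Lemma gorb_xX z w j : w \in gorb z -> (x ^+ j) w \in gorb z.
Proof.
move=> h; elim: j => [|j IH]; first by rewrite expg0 perm1.
by rewrite expgSr permM; apply: porb_gen => //; exact: ambient_x.
Qed.

Lemma gorb_xV z w j : (x ^+ j) w \in gorb z -> w \in gorb z.
Proof. by move=> h; rewrite -(porb_eq h); apply/porb_sym/gorb_xX/porb_id. Qed.

Lemma window_gorb g z : z \in X -> g \in window 0 K -> g z \in gorb z.
Proof.
move=> zX /windowP[->|->|[l lt ->]].
- exact/porb_gen/porb_id/ambient_u.
- exact/porb_gen/porb_id/ambient_v.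
apply: (@gorb_xV _ _ l); have /= := @xy z 0 l zX; rewrite add0n => <-; last by lia.
by apply: porb_gen; [exact: ambient_y | exact/gorb_xX/porb_id].
Qed.

Lemma orb_gorb lo hi z w : hi <= K -> z \in X -> w \in orb lo hi z -> w \in gorb z.
Proof.
move=> hK zX h; suff [] : w \in X /\ w \in gorb z by [].
move: h; apply: (@porb_ind _ _ z (fun w => w \in X /\ w \in gorb z)).
  by split=> //; exact: porb_id.
move=> g w' gA _ [wX wz]; have gK := subsetP (window_sub (leq0n lo) hK) _ gA.
by split; [exact: XG | rewrite -(porb_eq wz); exact: window_gorb].
Qed.

(** * Returns to a window orbit are rare outside short orbits *)

Variables (CQ B : nat).
Hypotheses (CQ_bound : forall z, #|orb 0 0 z| <= CQ) (B_bound : K * (CQ * 3 ^ K) <= B).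

Lemma card_orb_le j z : j <= K -> #|orb 0 j z| <= CQ * 3 ^ K.
Proof.
move=> jK; apply: leq_trans (@card_orb_high 0 0 j z _) _; first by [].
by rewrite mulnC; apply: leq_mul (CQ_bound z) _; rewrite leq_exp2l.
Qed.

(* The windowed orbit of [z] is then [x^c]-invariant. *)
Lemma periodic_small z c j : z \in X -> 0 < c <= j -> j + c <= K ->
  (x ^- c) z \in orb 0 j z -> (forall l, j <= l < j + c -> y l z \in orb 0 j z) ->
  #|gorb z| <= B.
Proof.
move=> zX cj jcK xz stop; set O := orb 0 j z.
(* The lamps of the next block keep [z] in [O], hence by commutation keep all of [O] in [O]:
   enlarging the window by this block does not enlarge the orbit. *)
have grow w : w \in orb 0 (j + c) z -> w \in O.
  apply: (@porb_ind _ _ z (fun w => w \in O)); first exact: porb_id.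
  move=> g w' gA _ IH; case: (boolP (g \in window 0 j)) => [|gN]; first by move/porb_gen; exact.
  have [l lt eg] : exists2 l, j <= l < j + c & g = y l.
    case/windowP: gA gN => [->|->|[l lt ->]]; rewrite ?window_u ?window_v // => h.
    by exists l => //; apply: contraNT h => ?; apply: window_y; lia.
  rewrite eg /O -(porb_eq (stop l lt)).
  by apply: orb_comm => //; [lia | apply: window_y; lia].
have xO w : w \in O -> (x ^- c) w \in O.
  move=> wO; apply: grow; have := orb_unshift zX jcK wO.
  rewrite add0n => /(orb_sub (leq0n c) (leqnn _)).
  by rewrite (porb_eq (orb_sub (leqnn 0) (leq_addr c j) xz)).
have xOO : [set (x ^- c) w | w in O] = O.
  apply/eqP; rewrite eqEcard card_imset ?leqnn ?andbT; last exact: perm_inj.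
  by apply/subsetP => _ /imsetP[w wO ->]; exact: xO.
have xcO w : w \in O -> (x ^+ c) w \in O.
  by rewrite -{1}xOO => /imsetP[w' wO ->]; rewrite -permM mulVg perm1.
(* The union of the [x ^+ i] images of [O] for [i < c] is invariant under the four generators, so it
   contains the whole ambient orbit. *)
pose Z := [set (x ^+ (p : 'I_c * T).1) p.2 | p in setX [set: 'I_c] O].
have ZP i w : i < c -> w \in O -> (x ^+ i) w \in Z.
  by move=> ic wO; apply/imsetP; exists (Ordinal ic, w); rewrite ?inE.
have sub : gorb z \subset Z.
  apply/subsetP; apply: (@porb_ind _ _ z (fun w => w \in Z)).
    by rewrite -[z]perm1 -(expg0 x); apply: ZP; [lia | exact: porb_id].
  move=> g w' gA _ /imsetP[[[i ic] w]]; rewrite !inE /= => wO -> {w'}.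
  have wX : w \in X by apply: orb_X wO => //; lia.
  have [->|[->|[->|->]]] : g = u \/ g = v \/ g = x \/ g = y 0.
    by move: gA; rewrite !inE -!orbA => /or4P[] /eqP; auto.
  - by rewrite xu //; [apply/ZP/porb_gen => //; exact: window_u | lia].
  - by rewrite xv //; [apply/ZP/porb_gen => //; exact: window_v | lia].
  - rewrite -permM -expgSr; have [ic'|] := ltnP i.+1 c; first exact: ZP.
    move=> ge; have -> : i.+1 = c by lia.
    by rewrite -[_ w]perm1 -(expg0 x); apply: ZP; [lia | exact: xcO].
  rewrite (@xy w 0 i) //; last by lia.
  by apply/ZP/porb_gen => //; apply: window_y; lia.
apply: leq_trans (subset_leq_card sub) _; apply: leq_trans (leq_imset_card _ _) _.
rewrite cardsX cardsT card_ord; apply: leq_trans B_bound.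
by apply: leq_mul; [lia | apply: card_orb_le; lia].
Qed.

(** If a point [o] returns after [c] steps, then by [periodic_small] each of [L] successive blocks
    of [c] lamps contains a lamp that leaves the orbit of the window below the block. By
    [orb_stab_transport] the lamps found at one [o] serve for all points of [D], and they yield [L]
    disjoint translates of [D]. *)
Lemma returns_rare z0 m c L : z0 \in X -> (forall w, w \in orb 0 K z0 -> B < #|gorb w|) ->
  0 < c <= m -> m + L * c <= K ->
  L * #|[set w in orb 0 K z0 | (x ^- c) w \in orb 0 m w]| <= #|orb 0 K z0|.
Proof.
move=> z0X big cm mK; set O := orb 0 K z0; set D := [set w in O | _].
have [->|[o]] := set_0Vmem D; first by rewrite cards0 muln0.
rewrite inE => /andP[oO xo]; have oX := orb_X (leqnn K) z0X oO.
have jb (b : 'I_L) : m + b * c + c <= K.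
  by apply: leq_trans mK; rewrite -addnA leq_add2l -mulSnr leq_mul2r ltn_ord orbT.
have /fin_all_exists[f fP] (b : 'I_L) : exists l, m + b * c <= l < m + b * c + c /\
    y l o \notin orb 0 (m + b * c) o.
  apply: contrapT => no; have := big o oO; rewrite ltnNge => /negP; apply.
  apply: (@periodic_small o c (m + b * c)) => //; first by lia.
    by apply: orb_sub xo => //; exact: leq_addr.
  by move=> l lt; apply/negPn/negP => h; apply: no; exists l.
(* The translates of [D] by the [y (f b - c)] are disjoint: a common point of two of them would
   bring [y (f b)] back into the smaller window. *)
pose F (p : 'I_L * T) := y (f p.1 - c) p.2.
have Fsub : [set F p | p in setX [set: 'I_L] D] \subset O.
  apply/subsetP => w' /imsetP[[b w]]; rewrite !inE /= => /andP[wO _] -> {w'}.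
  have [lt _] := fP b; have := jb b => ?; rewrite /F /=.
  by apply: porb_gen => //; apply: window_y; lia.
have key (b b' : 'I_L) w1 w2 : w1 \in D -> w2 \in D -> b' < b -> F (b, w1) <> F (b', w2).
  rewrite !inE /F /= => /andP[w1O x1] /andP[w2O x2] bb e.
  have [lt nf] := fP b; have [lt' _] := fP b'; have jbK := jb b; have jbK' := jb b'.
  have J' : m + b' * c + c <= m + b * c.
    by rewrite -addnA leq_add2l -mulSnr leq_mul2r bb orbT.
  have mJ : m <= m + b * c by exact: leq_addr.
  move: J' mJ lt nf jbK; move: (m + b * c) => J J' mJ lt nf jbK.
  have cf : c <= f b by move: lt mJ cm; clear; lia.
  have cf' : c <= f b' by case/andP: cm => _ h; case/andP: lt' => h' _; rewrite (leq_trans h) // (leq_trans _ h') // leq_addr.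
  have fJ : f b - c < J by move: lt mJ cm; clear; lia.
  have fJ' : f b' - c < J by move: lt' cm J'; clear; lia.
  have fK : f b < K by move: lt jbK; clear; lia.
  have fK' : f b' < K by move: lt' jbK'; clear; lia.
  (* Both translating indices lie below [J], so the common point puts [w1] and [w2] in one orbit of
     the window below [J]. *)
  have w21 : orb 0 J w2 = orb 0 J w1.
    have h2 : y (f b' - c) w2 \in orb 0 J w2.
      by apply/porb_gen/porb_id/window_y.
    have h1 : y (f b - c) w1 \in orb 0 J w1.
      by apply/porb_gen/porb_id/window_y.
    by rewrite -(porb_eq h2) -e (porb_eq h1).
  have w1X := orb_X (leqnn K) z0X w1O; have w2X := orb_X (leqnn K) z0X w2O.
  set p1 := (x ^- c) w1 in x1; set p2 := (x ^- c) w2 in x2.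
  have e12 : y (f b) p1 = y (f b') p2.
    have h1 := @xVy w1 (f b - c) c w1X; have h2 := @xVy w2 (f b' - c) c w2X.
    rewrite (subnK cf) in h1; rewrite (subnK cf') in h2.
    by rewrite /p1 /p2 h1 ?h2 ?e.
  have {}x1 : p1 \in orb 0 J w1 by apply: orb_sub x1.
  have {}x2 : p2 \in orb 0 J w1 by rewrite -w21; apply: orb_sub x2.
  have : y (f b) p1 \in orb 0 J p1.
    rewrite e12 (porb_eq x1); apply: porb_gen => //; apply: window_y.
    by move: lt' J'; clear; lia.
  have JK : J <= K by move: jbK; clear; lia.
  have op : o \in orb 0 K p1.
    by rewrite (porb_eq (orb_sub (leqnn 0) JK x1)) (porb_eq w1O).
  by move/(orb_stab_transport JK fK op); rewrite (negPf nf).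
apply: leq_trans (subset_leq_card Fsub); rewrite card_in_imset.
  by rewrite cardsX cardsT card_ord.
move=> [b w1] [b' w2]; rewrite !in_setX !in_setT /= => w1D w2D e.
case: (ltngtP b b') => [lt|lt|/val_inj eb].
- by case: (key _ _ _ _ w2D w1D lt).
- by case: (key _ _ _ _ w1D w2D lt).
by move: e; rewrite /F eb /= => /perm_inj ->.
Qed.

(** * Tiles and eligible points *)

Definition tile m z : {set T} :=
  [set (x ^+ (p : 'I_m * T).1) p.2 | p in setX [set: 'I_m] (orb 0 m z)].

(** This is what makes the map from [O x Z/m] onto the tile injective, where [O] is the window
    orbit. *)
Definition nonper m z : bool :=
  [forall w in orb 0 m z, forall c : 'I_m, (0 < c) ==> ((x ^- c) w \notin orb 0 m z)].

Lemma mem_tile m z i w : i < m -> w \in orb 0 m z -> (x ^+ i) w \in tile m z.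
Proof. by move=> im wz; apply/imsetP; exists (Ordinal im, w); rewrite ?inE. Qed.

Lemma tileP m z p : p \in tile m z ->
  exists i w, [/\ i < m, w \in orb 0 m z & p = (x ^+ i) w].
Proof. by case/imsetP=> -[i w]; rewrite !inE /= => wz ->; exists i, w; split. Qed.

Lemma tile_eq m z w : w \in orb 0 m z -> tile m w = tile m z.
Proof. by move=> wz; rewrite /tile (porb_eq wz). Qed.

Lemma nonper_eq m z w : w \in orb 0 m z -> nonper m w = nonper m z.
Proof. by move=> wz; rewrite /nonper (porb_eq wz). Qed.

Lemma nonper_tile_inj m z i j w w' : nonper m z -> i < m -> j < m ->
  w \in orb 0 m z -> w' \in orb 0 m z -> (x ^+ i) w = (x ^+ j) w' -> i = j /\ w = w'.
Proof.
move=> np; wlog le : i j w w' / i <= j => [H im jm wz wz' e|im jm wz wz' e].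
  case: (leqP i j) => [le|/ltnW le]; first exact: H.
  by have [-> ->] := H j i w' w le jm im wz' wz (esym e).
have [ij|ne] := eqVneq i j; first by move: e; rewrite ij => /perm_inj ->.
have cm : j - i < m by lia.
move/forall_inP/(_ w wz)/forallP/(_ (Ordinal cm)): np => /=.
have e' : (x ^- (j - i)) w = w'.
  apply: (@perm_inj _ (x ^+ (j - i))); rewrite permKV; apply: (@perm_inj _ (x ^+ i)).
  by rewrite e -permM -expgD subnK.
by rewrite e' wz' subn_gt0 ltn_neqAle ne le.
Qed.

Lemma card_tile m z : nonper m z -> #|tile m z| = (m * #|orb 0 m z|)%N.
Proof.
move=> np; rewrite card_in_imset ?cardsX ?cardsT ?card_ord //.
move=> [i w] [j w']; rewrite !inE /= => wz wz' e.
by have [/val_inj -> ->] := nonper_tile_inj np (ltn_ord i) (ltn_ord j) wz wz' e.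
Qed.

Lemma card_tile_le m z : m <= K -> #|tile m z| <= K * (CQ * 3 ^ K).
Proof.
move=> mK; apply: leq_trans (leq_imset_card _ _) _.
by rewrite cardsX cardsT card_ord; apply: leq_mul (card_orb_le _ _).
Qed.

Lemma tile_gorb m z p : m <= K -> z \in X -> p \in tile m z -> p \in gorb z.
Proof.
by move=> mK zX /tileP[i [w [_ wz ->]]]; apply: gorb_xX; apply: orb_gorb wz.
Qed.

Definition small : {set T} := [set z | #|gorb z| <= B].
Definition large : {set T} := X :\: small.

Lemma in_large z : (z \in large) = (B < #|gorb z|) && (z \in X).
Proof. by rewrite in_setD inE -ltnNge. Qed.

Lemma large_closed g z : g \in window 0 K -> z \in large -> g z \in large.
Proof.
rewrite !in_large => gK /andP[big zX]; rewrite (XG gK zX) andbT.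
by rewrite (porb_eq (window_gorb zX gK)).
Qed.

Lemma orb_large j z w : j <= K -> z \in large -> w \in orb 0 j z -> w \in large.
Proof.
move=> jK zL; apply: (@porb_ind _ _ z (fun w => w \in large)) => // g w' gA _.
by apply: large_closed; apply: (subsetP (window_sub (leqnn 0) jK)).
Qed.

Lemma large_X z : z \in large -> z \in X.
Proof. by rewrite in_large => /andP[]. Qed.

Lemma card_returns m c L : 0 < c <= m -> m + L * c <= K ->
  L * #|[set z in large | (x ^- c) z \in orb 0 m z]| <= #|T|.
Proof.
move=> cm mK; apply: leq_trans (max_card large).
rewrite -sum1_card -sum1_card big_distrr /= muln1.
rewrite (eq_bigl (fun z => (z \in large) && ((x ^- c) z \in orb 0 m z))); last first.
  by move=> z; rewrite inE.
rewrite big_mkcondr /=.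
apply: (@leq_sum_porb _ (window 0 K)) => [g z|z zL]; first exact: large_closed.
rewrite -big_mkcondr /= sum1_card.
have := @returns_rare z m c L (large_X zL) _ cm mK.
rewrite -sum1_card big_distrr /= muln1 => H.
rewrite (eq_bigl (fun w => w \in [set w in orb 0 K z | (x ^- c) w \in orb 0 m w])).
  by apply: H => w wz; have := orb_large (leqnn K) zL wz; rewrite in_large => /andP[].
by move=> w; rewrite inE.
Qed.

Lemma card_periodic m L : 2 * m + L * m <= K ->
  L * #|[set z in large | ~~ nonper m z]| <= m * #|T|.
Proof.
move=> mK.
(* A return at some [w] in the orbit of [z] becomes a return at [z] itself once the window is
   widened: applying [x ^- c] to the path from [w] to [z] shifts its lamps by [c < m], whence
   [2 * m]. *)
have sub : [set z in large | ~~ nonper m z] \subset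
    \bigcup_(c < m | 0 < c) [set z in large | (x ^- c) z \in orb 0 (2 * m) z].
  apply/subsetP => z; rewrite inE => /andP[zL].
  rewrite negb_forall_in => /exists_inP[w wz]; rewrite negb_forall => /existsP[c].
  rewrite negb_imply negbK => /andP[c0 cw]; apply/bigcupP; exists c => //.
  rewrite inE zL /=.
  have cm : c < m := ltn_ord c.
  have wX : w \in X by apply: orb_X (large_X zL) wz; lia.
  have le : m + c <= K by lia.
  have := orb_unshift wX le (porb_sym wz); rewrite add0n => h.
  have {}h : (x ^- c) z \in orb 0 (2 * m) ((x ^- c) w) by apply: orb_sub h; lia.
  have cw' : (x ^- c) w \in orb 0 (2 * m) z by apply: orb_sub cw; lia.
  by rewrite -(porb_eq cw').
apply: leq_trans (leq_mul (leqnn L) (subset_leq_card sub)) _.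
apply: (@leq_trans (L * \sum_(c < m | 0 < c)
    #|[set z in large | (x ^- c) z \in orb 0 (2 * m) z]|)).
  rewrite leq_mul2l; apply/orP; right.
  elim/big_rec2: _ => [|c n A _ IH]; first by rewrite cards0.
  by apply: leq_trans (leq_card_setU _ _) _; rewrite leq_add2l.
rewrite big_distrr /=; apply: (@leq_trans (\sum_(c < m | 0 < c) #|T|)).
  apply: leq_sum => c c0; apply: card_returns; first by have := ltn_ord c; lia.
  by apply: leq_trans mK; rewrite leq_add2l leq_mul2l ltnW ?orbT.
rewrite big_mkcond /= -[X in _ <= X * _](card_ord m) -sum_nat_const.
by apply: leq_sum => c _; case: ifP.
Qed.

Definition eligible m (Y : {set T}) : {set T} :=
  [set z in large | nonper m z & [disjoint tile m z & Y]].

Lemma in_eligible m Y z : (z \in eligible m Y) =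
  [&& z \in large, nonper m z & [disjoint tile m z & Y]].
Proof. by rewrite in_set. Qed.

(** The gain of a maximal round: if no eligible tile can be added because each meets [Y] too much,
    then [Y] has grown by a definite part of the number of eligible points. *)
Lemma card_eligible m N (Y0 Y : {set T}) : 0 < m <= K ->
  (forall z, z \in eligible m Y0 -> #|tile m z| <= N * #|tile m z :&: Y|) ->
  #|eligible m Y0| <= N * #|Y :\: Y0|.
Proof.
move=> /andP[m0 mK] H; set E := eligible m Y0.
(* The sets [x^i @: eligible m Y0], [i < m], cover each point at most [m] times. *)
rewrite -(leq_pmul2l m0); apply: (@leq_trans
  (\sum_(z in E) N * \sum_(i < m) ((x ^+ i) z \in Y :\: Y0))).
  rewrite mulnC -sum_nat_const; apply: (@leq_sum_porb _ (window 0 m)) => [g z gA|z zE].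
    rewrite !in_eligible => /and3P[zL h3 h4].
    have gz : g z \in orb 0 m z by apply/porb_gen/porb_id.
    rewrite (nonper_eq gz) (tile_eq gz) h3 h4 !andbT.
    by apply: large_closed => //; apply: (subsetP (window_sub (leqnn 0) mK)).
  have [_ np dis] : [/\ z \in large, nonper m z & [disjoint tile m z & Y0]].
    by move: zE; rewrite in_eligible => /and3P[].
  rewrite sum_nat_const mulnC -(card_tile np); apply: leq_trans (H z zE) _.
  rewrite -big_distrr /= leq_mul2l; apply/orP; right.
  rewrite pair_big_dep /=.
  rewrite (eq_bigr (fun p : T * 'I_m => nat_of_bool ((x ^+ p.2) p.1 \in Y :\: Y0))) //.
  rewrite (eq_bigl (fun p : T * 'I_m => p.1 \in orb 0 m z)); last by move=> p; rewrite andbT.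
  rewrite (bigID (fun p : T * 'I_m => (x ^+ p.2) p.1 \in Y :\: Y0)) /=.
  apply: leq_trans (leq_addr _ _).
  apply: (@leq_trans #|[set p : T * 'I_m | (p.1 \in orb 0 m z) && ((x ^+ p.2) p.1 \in Y :\: Y0)]|).
    apply: (@leq_trans #|[set (x ^+ (p : T * 'I_m).2) p.1 | p in
        [set p : T * 'I_m | (p.1 \in orb 0 m z) && ((x ^+ p.2) p.1 \in Y :\: Y0)]]|).
      apply/subset_leq_card/subsetP => q; rewrite inE => /andP[qt qY].
      have [i [w [im wz e]]] := tileP qt.
      apply/imsetP; exists (w, Ordinal im) => //; rewrite !inE /= wz -e qY andbT /=.
      by apply: contraTN qt => q0; move: dis; rewrite disjoint_subset => /subsetP h;
         apply/negP => /h; rewrite inE q0.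
    exact: leq_imset_card.
  rewrite cardsE -sum1_card; apply: leq_sum => p /andP[_ ->] //.
rewrite -big_distrr /= mulnCA leq_mul2l; apply/orP; right.
rewrite exchange_big /= -[X in _ <= X * _](card_ord m) -sum_nat_const.
apply: leq_sum => i _; rewrite -(card_preimset (Y :\: Y0) (@perm_inj _ (x ^+ i))).
rewrite -sum1_card big_mkcond [X in _ <= X]big_mkcond /=; apply: leq_sum => z _.
by case: ifP => // _; rewrite [z \in _ @^-1: _]in_set; case: (_ \in _).
Qed.

(** * The greedy quasi-tiling *)

Variables (G0 : {set T}) (N : nat).
Hypotheses (G0_closed : forall g z, g \in ambient -> z \in G0 -> g z \in G0)
  (N0 : 0 < N) (B_bound' : N * (K * (CQ * 3 ^ K)) <= B)
  (X_loss : 8 * N * #|~: X| <= #|T|) (small_loss : 8 * N * #|small :\: G0| <= #|T|).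

Implicit Type t : seq (nat * T).

Fixpoint cover t : {set T} :=
  if t is (m, o) :: t' then tile m o :|: cover t' else G0.

(** Overlaps are counted repeatedly: this is the size of the disjoint union of actions that will
    replace the tiling, and it must not exceed [#|T|]. *)
Fixpoint mass t : nat :=
  if t is (m, o) :: t' then #|tile m o| + mass t' else #|G0|.

Variable Mmax : nat.

Fixpoint quasi_tiling t : Prop :=
  if t is (m, o) :: t' then
    [/\ o \in large, nonper m o, N * #|tile m o :&: cover t'| <= #|tile m o|,
        N <= m <= Mmax & quasi_tiling t']
  else True.

Lemma cover_mass t : #|cover t| <= mass t.
Proof.
elim: t => [|[m o] t IH] //=; apply: leq_trans (leq_card_setU _ _) _.
by rewrite leq_add2l.
Qed.

Lemma G0_cover t : G0 \subset cover t.
Proof. by elim: t => [|[m o] t IH] //=; apply: subset_trans IH (subsetUr _ _). Qed.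

Lemma coverP t p : p \in cover t -> p \in G0 \/
  exists m o, (m, o) \in t /\ p \in tile m o.
Proof.
elim: t => [|[m o] t IH] /=; first by left.
rewrite in_setU => /orP[h|/IH[|[m' [o' [h h']]]]]; [right|by left|right].
  by exists m, o; rewrite mem_head.
by exists m', o'; rewrite in_cons h orbT.
Qed.

Lemma tile_cover t m o : (m, o) \in t -> tile m o \subset cover t.
Proof.
elim: t => [|[m' o'] t IH] //=; rewrite in_cons => /orP[/eqP[-> ->]|/IH h].
  exact: subsetUl.
by apply: subset_trans h (subsetUr _ _).
Qed.

Lemma quasi_tiling_mem t m o : quasi_tiling t -> (m, o) \in t ->
  [/\ o \in large, nonper m o & N <= m <= Mmax].
Proof.
elim: t => [|[m' o'] t IH] //= [h1 h2 h3 h4 h5]; rewrite in_cons => /orP[/eqP[-> ->]|] //.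
exact: IH.
Qed.

(* Points whose [m]-tile may meet the tile of scale [M] at [o] without being contained in it. *)
Definition boundary m M o : {set T} :=
  (\bigcup_(c in [set: 'I_m]) orb 0 (M + c) ((x ^- c) o)) :|:
  (\bigcup_(k in [set: 'I_m]) [set (x ^+ (M - k)) w | w in orb 0 (M + m) o]).

(** Each of the [2 * m] pieces is a translate of [orb 0 M o] enlarged by at most [m] lamps, below
    the window for the first family and above it for the second. *)
Lemma card_boundary m M o : o \in X -> M + m <= K ->
  #|boundary m M o| <= 2 * m * 3 ^ m * #|orb 0 M o|.
Proof.
move=> oX MK; apply: leq_trans (leq_card_setU _ _) _.
have -> : (2 * m * 3 ^ m * #|orb 0 M o|)%N =
    (m * (3 ^ m * #|orb 0 M o|) + m * (3 ^ m * #|orb 0 M o|))%N by lia.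
apply: leq_add; rewrite -[X in _ <= X * _](card_ord m) -cardsT;
  apply: card_bigcup_le => c _; have cm := ltn_ord c.
  have := @card_orb_low c (M + c) c ((x ^- c) o) ltac:(lia) ltac:(lia).
  rewrite subnn => /leq_trans; apply; apply: leq_mul; first by rewrite leq_exp2l // ltnW.
  have sub : orb c (M + c) ((x ^- c) o) \subset [set (x ^- c) w | w in orb 0 M o].
    apply/subsetP => w; rewrite -{1}[nat_of_ord c]add0n.
    move/(orb_unshift_inv oX) => /(_ ltac:(lia))[w' wo ->].
    exact: imset_f.
  by apply: leq_trans (subset_leq_card sub) (leq_imset_card _ _).
by apply: leq_trans (leq_imset_card _ _) _; exact: card_orb_high.
Qed.

(** At a common point [(x ^+ i) w = (x ^+ j) o'] the tile of [z] starts [i - j] levels below the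
    large one if [j < i], which is the first family. Otherwise it starts [j - i] levels up: either
    all its [m] levels fit and [z] is in the large tile, or it starts among the top [m] levels,
    which is the second family. *)
Lemma in_boundary m M o z : o \in X -> M + m <= K -> m <= M -> z \in X ->
  z \notin tile M o -> ~~ [disjoint tile m z & tile M o] -> z \in boundary m M o.
Proof.
move=> oX MK mM zX zN /pred0Pn[p /= /andP[]].
case/tileP=> i [w [im wz ->]] /tileP[j [o' [jM oo e]]].
have o'X : o' \in X by apply: orb_X oX oo; lia.
have zw := porb_sym wz; rewrite in_setU.
have [ji|ij] := ltnP j i.
  have cm : i - j < m by lia.
  have ew : w = (x ^- (i - j)) o'.
    apply: (@perm_inj _ (x ^+ (i - j))); rewrite permKV; apply: (@perm_inj _ (x ^+ j)).
    by rewrite -e -permM -expgD subnK // ltnW.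
  apply/orP; left; apply/bigcupP; exists (Ordinal cm); rewrite ?in_setT //=.
  have h1 := @orb_unshift 0 M (i - j) o o' oX ltac:(lia) oo.
  have h2 : (x ^- (i - j)) o' \in orb 0 (M + (i - j)) ((x ^- (i - j)) o) by apply: orb_sub h1.
  by rewrite -(porb_eq h2) -ew; apply: orb_sub zw => //; lia.
have ew : w = (x ^+ (j - i)) o'.
  by apply: (@perm_inj _ (x ^+ i)); rewrite e -permM -expgD subnK.
move: zw; rewrite ew => /(orb_shift o'X) => /(_ ltac:(lia))[w' wo' ez].
have [le|gt] := leqP (j - i + m) M.
  case/negP: zN; rewrite ez; apply: mem_tile; first by lia.
  by rewrite -(porb_eq oo); apply: orb_sub wo'; lia.
have km : M - (j - i) < m by lia.
apply/orP; right; apply/bigcupP; exists (Ordinal km); rewrite ?in_setT //=.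
have -> : M - (M - (j - i)) = j - i by lia.
rewrite ez; apply: imset_f.
by rewrite -(porb_eq (orb_sub (leqnn 0) (leq_addr m M) oo)); apply: orb_sub wo'; lia.
Qed.

Fixpoint boundaries m t : {set T} :=
  if t is (M, o) :: t' then boundary m M o :|: boundaries m t' else set0.

Lemma mem_boundaries m t M o : (M, o) \in t -> boundary m M o \subset boundaries m t.
Proof.
elim: t => [|[m' o'] t IH] //=; rewrite in_cons => /orP[/eqP[-> ->]|/IH h].
  exact: subsetUl.
by apply: subset_trans h (subsetUr _ _).
Qed.

Definition scales_ge g t := forall M o, (M, o) \in t -> g <= M.

Lemma card_boundaries m g t : quasi_tiling t -> Mmax + m <= K -> scales_ge g t ->
  g * #|boundaries m t| <= 2 * m * 3 ^ m * mass t.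
Proof.
move=> + MK; elim: t => [|[M o] t IH] /=; first by rewrite cards0 muln0.
case=> [oL np _ /andP[_ MM] qt] ge.
have {}IH : g * #|boundaries m t| <= 2 * m * 3 ^ m * mass t.
  by apply: IH => // M' o' h; apply: (ge _ o'); rewrite in_cons h orbT.
have gM : g <= M by apply: (ge M o); rewrite mem_head.
apply: leq_trans (leq_mul (leqnn g) (leq_card_setU _ _)) _.
rewrite mulnDr [X in _ <= X]mulnDr; apply: leq_add IH.
have := card_boundary (m := m) (M := M) (large_X oL) ltac:(lia) => h.
apply: leq_trans (leq_mul gM h) _.
by rewrite (card_tile np) !mulnA; apply: eq_leq; lia.
Qed.

Hypothesis KMmax : 2 * Mmax + 8 * N * Mmax * Mmax <= K.

Lemma Mmax_K : 2 * Mmax <= K.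
Proof. exact: leq_trans (leq_addr _ _) KMmax. Qed.

(** An uncovered point that is not eligible lies outside [X], or in a bad short orbit, or is
    periodic at scale [m], or is in a boundary. Each of the four sets has at most [#|T| / (8 N)]
    points. *)
Lemma uncovered_loss m t : quasi_tiling t -> mass t <= #|T| -> 0 < m <= Mmax ->
  scales_ge (16 * N * m * 3 ^ m) t ->
  2 * N * (#|T| - #|cover t|) <= 2 * N * #|eligible m (cover t)| + #|T|.
Proof.
move=> qt mt /andP[m0 mM] ge; set Y := cover t.
have sub : ~: Y \subset eligible m Y :|: (~: X :|: ((small :\: G0) :|:
    ([set z in large | ~~ nonper m z] :|: boundaries m t))).
  apply/subsetP => z; rewrite in_setC => zY; rewrite !in_setU.
  case: (boolP (z \in ~: X)) => [|zX]; first by rewrite orbT.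
  have {}zX : z \in X by move: zX; rewrite in_setC negbK.
  have zG : z \notin G0 by apply: contra zY => h; apply: (subsetP (G0_cover t)).
  case: (boolP (z \in small)) => [zs|zs]; first by rewrite in_setD zG zs !orbT.
  have zL : z \in large by rewrite in_setD zs.
  case: (boolP (nonper m z)) => np; last by rewrite [z \in [set _ | _]]in_set zL np !orbT.
  case: (boolP (z \in eligible m Y)) => //; rewrite in_eligible zL np /=.
  case/pred0Pn=> p /= /andP[pz /coverP[pG|[M [o [mo po]]]]].
    (* A tile meeting [G0] lies in an ambient orbit inside [G0], so its base point was already
       covered. *)
    have zp : z \in gorb p by apply/porb_sym; apply: tile_gorb pz => //; move: mM Mmax_K; clear; lia.
    case/negP: zG; apply: (@porb_ind _ _ p (fun z => z \in G0)) zp => // g w gA _.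
    exact: G0_closed.
  have [oL npo MM] := quasi_tiling_mem qt mo; have gM := ge _ _ mo.
  suff -> : z \in boundaries m t by rewrite !orbT.
  apply: (subsetP (mem_boundaries m mo)); apply: in_boundary => //.
  - exact: large_X oL.
  - by move: MM mM Mmax_K; clear; lia.
  - exact: leq_trans (leq_scale_step m N0) gM.
  - by apply: contra zY => h; apply: (subsetP (tile_cover mo)).
  by apply/pred0Pn; exists p => /=; rewrite pz.
have c1 : #|T| - #|Y| <= #|eligible m Y| + (#|~: X| + (#|small :\: G0| +
    (#|[set z in large | ~~ nonper m z]| + #|boundaries m t|))).
  have -> : #|T| - #|Y| = #|~: Y| by have := cardsC Y; lia.
  apply: leq_trans (subset_leq_card sub) _.
  do 3 (apply: leq_trans (leq_card_setU _ _) _; rewrite leq_add2l).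
  exact: leq_card_setU.
have c2 : 8 * N * #|[set z in large | ~~ nonper m z]| <= #|T|.
  rewrite -(leq_pmul2l m0); apply: leq_trans (@card_periodic m (8 * N * m) _).
    by move: #|[set z in large | ~~ nonper m z]| => n; clear; apply: eq_leq; lia.
  apply: leq_trans KMmax; apply: leq_add; first by rewrite leq_mul2l.
  by apply: leq_mul => //; apply: leq_mul.
have c3 : 8 * N * #|boundaries m t| <= #|T|.
  have p0 : 0 < 2 * m * 3 ^ m by rewrite !muln_gt0 m0 expn_gt0.
  rewrite -(leq_pmul2l p0); have MK : Mmax + m <= K by move: mM Mmax_K; clear; lia.
  have := card_boundaries qt MK ge => h.
  have h2 : 2 * m * 3 ^ m * mass t <= 2 * m * 3 ^ m * #|T| by rewrite leq_mul2l mt orbT.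
  apply: leq_trans h2; apply: leq_trans h; move: #|boundaries m t| (3 ^ m)%N => n k.
  by clear; apply: eq_leq; lia.
move: c1 c2 c3 X_loss small_loss; clear.
move: #|~: X| #|small :\: G0| #|[set z in large | ~~ nonper m z]| #|boundaries m t|.
move=> a b c e; move: #|eligible m Y| #|Y| #|T| => f g n.
move=> h1 h2 h3 h4 h5.
have := leq_mul (leqnn (8 * N)) h1.
rewrite !mulnDr; lia.
Qed.

(** A large point forces [#|T| > B], and [B] is at least [N] times the largest size of a tile. *)
Lemma tile_mass m z : z \in large -> m <= K -> N * #|tile m z| <= #|T|.
Proof.
rewrite in_large => /andP[big _] mK.
apply: leq_trans (leq_mul (leqnn N) (card_tile_le z mK)) _.
by apply: leq_trans B_bound' _; apply: leq_trans (ltnW big) (max_card _).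
Qed.

(** Tiles of scale [m] disjoint from the cover at the start of the round are added as long as one of
    them overlaps the current cover in at most a part [1 / N]. If the next one would make the mass
    exceed [#|T|], the missing mass is less than one tile and the tiling is complete; otherwise the
    round is maximal and [card_eligible] applies. *)
Lemma tiling_round m g t : quasi_tiling t -> mass t <= #|T| -> N <= m <= Mmax ->
  scales_ge g t -> m <= g -> exists t', [/\ quasi_tiling t', mass t' <= #|T|,
    scales_ge m t', cover t \subset cover t' &
    N * (#|T| - mass t') <= #|T| \/
    #|eligible m (cover t)| <= N * #|cover t' :\: cover t| ].
Proof.
move=> qt mt mM gt mg; set Y := cover t.
have mK : m <= K by move: mM Mmax_K; clear; lia.
suff H n t' : #|T| - mass t' < n -> quasi_tiling t' -> mass t' <= #|T| ->
    scales_ge m t' -> Y \subset cover t' -> exists t'', [/\ quasi_tiling t'',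
      mass t'' <= #|T|, scales_ge m t'', Y \subset cover t'' &
      N * (#|T| - mass t'') <= #|T| \/ #|eligible m Y| <= N * #|cover t'' :\: Y| ].
  by apply: H (ltnSn _) qt mt _ _ => // M o /gt; exact: leq_trans.
elim: n t' => // n IH t' lt qt' mt' ge' sub.
have [/existsP[z /andP[zE zt]]|no] :=
    boolP [exists z, (z \in eligible m Y) && (N * #|tile m z :&: cover t'| <= #|tile m z|)].
  have [zL np _] : [/\ z \in large, nonper m z & [disjoint tile m z & Y]].
    by move: zE; rewrite in_eligible => /and3P[].
  have [fits|over] := leqP (mass ((m, z) :: t')) #|T|.
    apply: (IH ((m, z) :: t')) => //=; last exact: subset_trans sub (subsetUr _ _).
      have t0 : 0 < #|tile m z|.
        apply/card_gt0P; exists z; rewrite -{1}[z]perm1 -(expg0 x).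
        by apply: mem_tile; [move: mM N0; clear; lia | exact: porb_id].
      by move: lt t0 fits => /=; clear; lia.
    by move=> M o; rewrite in_cons => /orP[/eqP[-> _] //|]; exact: ge'.
  exists t'; split=> //; left; apply: leq_trans (tile_mass zL mK).
  by rewrite leq_mul2l; move: over => /=; clear; lia.
exists t'; split=> //; right; apply: card_eligible.
  by rewrite mK andbT; move: mM N0; clear; lia.
move=> z zE; move: no; rewrite negb_exists => /forallP/(_ z).
by rewrite zE /= -ltnNge => /ltnW.
Qed.

Lemma scale_mono i j : i <= j -> scale N i <= scale N j.
Proof.
elim: j i => [|j IH] i; first by rewrite leqn0 => /eqP ->.
rewrite leq_eqVlt => /orP[/eqP -> //|/IH h]; apply: leq_trans h _ => /=.
exact: leq_scale_step.
Qed.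

Hypothesis Mmax_scale : Mmax = scale N (2 * N * N).

(* Each round of the greedy construction, at the next smaller scale, covers a further
   [1 / (2 N^2)] of the space. *)
Lemma quasi_tiling_exists : exists t,
  [/\ quasi_tiling t, mass t <= #|T| & N * (#|T| - mass t) <= #|T| ].
Proof.
have G0T : mass [::] <= #|T| by exact: max_card.
have rounds k : k <= 2 * N * N -> exists t, [/\ quasi_tiling t, mass t <= #|T|,
    scales_ge (scale N (2 * N * N - k)) t &
    N * (#|T| - mass t) <= #|T| \/ k * #|T| <= 2 * N * N * #|cover t| ].
  elim: k => [_|k IH lt].
    by exists [::]; split=> //; right; rewrite mul0n.
  have [t [qt mt ge H]] := IH (ltnW lt).
  set m := scale N (2 * N * N - k.+1).
  have mg : (16 * N * m * 3 ^ m)%N = scale N (2 * N * N - k).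
    by rewrite /m; have -> : (2 * N * N - k = (2 * N * N - k.+1).+1)%N by move: lt; clear; lia.
  have mM : m <= Mmax by rewrite Mmax_scale; apply: scale_mono; exact: leq_subr.
  have Nm : N <= m by exact: (scale_mono (leq0n _)).
  have mg' : m <= scale N (2 * N * N - k) by apply: scale_mono; rewrite leq_sub2l.
  have [done|more] := leqP (N * (#|T| - mass t)) #|T|.
    exists t; split=> //; last by left.
    by move=> M o /ge; exact: leq_trans.
  have [t' [qt' mt' ge' sub H']] := tiling_round qt mt (introT andP (conj Nm mM)) ge mg'.
  exists t'; split=> //; case: H' => [|el]; [by left | right].
  case: H => [|H]; first by rewrite leqNgt more.
  have := @uncovered_loss m t qt mt; rewrite mg mM andbT => /(_ (leq_trans N0 Nm) ge) loss.
  have cm := cover_mass t; have ct := max_card (cover t).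
  have eD : #|cover t'| = (#|cover t' :\: cover t| + #|cover t|)%N.
    by rewrite cardsD (setIidPr sub) subnK // subset_leq_card.
  move: el more loss H cm ct; rewrite eD; clear.
  move: #|cover t' :\: cover t| #|eligible m (cover t)| #|cover t| (mass t) #|T| => a e c M n.
  move=> el more loss H cm ct.
  (* While the tiling is incomplete, more than [n / N] points are uncovered; the losses account for
     at most [n / (2 N)] of them, and the rest are eligible, so the gain [a] is at least
     [n / (2 N ^ 2)]. *)
  have h1 : 2 * N * (n - c) <= 2 * N * (N * a) + n.
    by apply: leq_trans loss _; rewrite leq_add2r leq_mul2l el orbT.
  have h2 : n < N * (n - c) by apply: leq_trans more _; rewrite leq_mul2l leq_sub2l ?orbT.
  have h3 : n <= 2 * N * N * a.
    by move: h1 h2; rewrite -!mulnA; move: (N * (n - c))%N (N * (N * a))%N; lia.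
  by rewrite mulSn mulnDr; apply: leq_add.
have [t [qt mt _ H]] := rounds _ (leqnn _); exists t; split=> //; case: H => // H.
have := cover_mass t; have NN : 0 < 2 * N * N by rewrite !muln_gt0 N0.
move: H; rewrite leq_pmul2l // => h1 h2; have := leq_trans h1 h2.
by rewrite -subn_eq0 => /eqP ->; rewrite muln0.
Qed.

(** * From the quasi-tiling to an action *)

Variable Ker : word -> Prop.
Hypotheses (Ker_lamp : forall w, Ker w -> lamp_trivial w)
  (Ker_uv : forall w, Ker w -> ev_word u v w = 1)
  (G0_fixed : forall w z, Ker w -> z \in G0 -> ev_word (u * x) (v * y 0) w z = z).

(** The model is the tower over the window orbit of [o]. Apart from the part already covered by [Y],
    the given action differs from it only at the top level, which the tower closes up to level 0. *)
Lemma tile_model m o Y : o \in large -> nonper m o ->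
  N * #|tile m o :&: Y| <= #|tile m o| -> N <= m <= Mmax ->
  exists (D : finType) (sD tD : {perm D}) (C V : {set D}) (f : D -> T),
  [/\ (forall w c, Ker w -> c \in C -> ev_word sD tD w c = c),
      (forall c, (sD c \in C) = (c \in C)) /\ (forall c, (tD c \in C) = (c \in C)),
      #|C| = #|tile m o|,
      [/\ V \subset C, {in V &, injective f} & forall c, c \in V -> f c \in tile m o :\: Y] &
      N * #|[set c in C | ~~ [&& c \in V, sD c \in V, tD c \in V,
           f (sD c) == (u * x) (f c) & f (tD c) == (v * y 0) (f c)]]| <= 4 * #|tile m o| ].
Proof.
move=> oL np small_overlap mN.
have mK : m <= K by move: mN Mmax_K; clear; lia.
have mlt i : i < m -> i < K by move/leq_trans; apply.
have m0 : 0 < m by move: mN N0; clear; lia.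
pose C := setX (orb 0 m o) [set: 'I_m].
pose f (p : T * 'I_m) := (x ^+ p.2) p.1.
pose V := [set p in C | f p \notin Y].
pose sD := tower_s u m; pose tD := tower_t v y m.
have CP p : (p \in C) = (p.1 \in orb 0 m o) by rewrite inE inE andbT.
have finj : {in C &, injective f}.
  move=> [z i] [z' i']; rewrite !CP /= => zo zo' e.
  by have [/val_inj -> ->] := nonper_tile_inj np (ltn_ord i) (ltn_ord i') zo zo' e.
have orbE g z : g \in window 0 m -> (g z \in orb 0 m o) = (z \in orb 0 m o).
  move=> gA; apply/idP/idP; last exact: porb_gen.
  by move=> h; rewrite -(porb_eq h); apply/porb_sym/porb_gen/porb_id.
have sC c : (sD c \in C) = (c \in C).
  by rewrite !CP permE orbE // window_u.
have tC c : (tD c \in C) = (c \in C).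
  by rewrite !CP permE orbE ?orbE ?window_v // window_y //=.
have VC : V \subset C by apply/subsetP => p; rewrite inE => /andP[].
have fT p : p \in C -> f p \in tile m o by case: p => z i; rewrite CP => h; apply: mem_tile.
exists (T * 'I_m)%type, sD, tD, C, V, f; split.
- move=> w c Kw _; rewrite tower_lamp_trivial ?perm1 //; try exact: Ker_lamp; try exact: Ker_uv.
  + by move=> i j /mlt iK /mlt; exact: yC.
  + by move=> i /mlt; exact: y3.
  + by move=> i /mlt; exact: uy.
  by move=> i /mlt; exact: vy.
- by [].
- by rewrite (card_tile np) cardsX cardsT card_ord mulnC.
- split=> //.
    by move=> p p' /(subsetP VC) pC /(subsetP VC); exact: finj.
  by move=> p; rewrite inE => /andP[pC pY]; rewrite inE pY fT.
set bad := [set c in C | _]; pose last := [set c in C | (c.2.+1 == m)].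
have CVP c : (c \in C :\: V) = (c \in C) && (c \notin V) by rewrite inE andbC.
(* The constant 4 of [model]: the overlap with [Y], the top level, and the preimages of the overlap
   under the two generators, each at most a part [1 / N] of the tile. *)
have sub : bad \subset (C :\: V) :|: (last :|: ((sD @^-1: (C :\: V)) :|: (tD @^-1: (C :\: V)))).
  apply/subsetP => c; rewrite inE => /andP[cC]; apply: contraR.
  rewrite !in_setU !negb_or ![c \in _ @^-1: _]in_set !CVP sC tC cC !negbK.
  rewrite [c \in last]in_set cC /= => /and4P[cV cl sV tV]; rewrite cV sV tV /=.
  case: c cC cl {cV sV tV} => z i; rewrite CP /= => zo il.
  have zX : z \in X by apply: orb_X (large_X oL) zo.
  have im := ltn_ord i; have iK := mlt i im.
  have eS : sD (z, i) = (u z, alpha_perm m i) by rewrite permE.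
  have eT : tD (z, i) = (y i (v z), i) by rewrite permE.
  have eA : alpha_perm m i = i.+1 :> nat.
    by rewrite permE /= modn_small //; move: im il; clear; lia.
  apply/andP; split; apply/eqP; rewrite /f ?eS ?eT /= permM ?eA.
    by rewrite expgSr permM xu // ltnW.
  by rewrite xv 1?ltnW // (@xy _ 0 i) ?add0n //; apply: XG; rewrite ?window_v.
have cCV : N * #|C :\: V| <= #|tile m o|.
  apply: leq_trans small_overlap; rewrite leq_mul2l; apply/orP; right.
  rewrite -(card_in_imset (f := f)); last first.
    by move=> p p'; rewrite !CVP => /andP[pC _] /andP[p'C _]; exact: finj.
  apply/subset_leq_card/subsetP => _ /imsetP[p + ->].
  rewrite CVP => /andP[pC]; rewrite inE pC /= negbK => pY.
  by rewrite inE fT.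
have clast : N * #|last| <= #|tile m o|.
  rewrite (card_tile np); apply: leq_mul; first by case/andP: mN.
  rewrite -(card_in_imset (f := fst)); last first.
    move=> [z i] [z' i']; rewrite !inE /= => /andP[_ /eqP e] /andP[_ /eqP e'] ->.
    by congr (_, _); apply: val_inj => /=; move: e e' => /=; clear; lia.
  apply/subset_leq_card/subsetP => _ /imsetP[p + ->].
  by rewrite inE CP => /andP[].
apply: leq_trans (leq_mul (leqnn N) (subset_leq_card sub)) _.
apply: leq_trans (leq_mul (leqnn N) (leq_card_setU _ _)) _.
rewrite mulnDr.
have h1 := leq_mul (leqnn N) (leq_card_setU last ((sD @^-1: (C :\: V)) :|: (tD @^-1: (C :\: V)))).
have h2 := leq_mul (leqnn N) (leq_card_setU (sD @^-1: (C :\: V)) (tD @^-1: (C :\: V))).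
rewrite mulnDr in h1; rewrite mulnDr !card_preimset in h2; try exact: perm_inj.
by move: h1 h2 cCV clast; clear; lia.
Qed.

Lemma quasi_tiling_model t : quasi_tiling t -> model Ker (u * x) (v * y 0) N (cover t) (mass t).
Proof.
elim: t => [_|[m o] t IH [oL np ov mN qt]].
  have inv (g : {perm T}) : (forall z, z \in G0 -> g z \in G0) ->
      forall z, (g z \in G0) = (z \in G0).
    move=> gG z; have e : g @: G0 = G0.
      apply/eqP; rewrite eqEcard card_imset ?leqnn ?andbT; last exact: perm_inj.
      by apply/subsetP => _ /imsetP[w wG ->]; exact: gG.
    by rewrite -{1}e mem_imset //; exact: perm_inj.
  apply: model_init => //; apply: inv => z zG; rewrite permM.
    by apply: G0_closed; [exact: ambient_x | apply: G0_closed; [exact: ambient_u |]].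
  by apply: G0_closed; [exact: ambient_y | apply: G0_closed; [exact: ambient_v |]].
by apply: model_add; [exact: IH | exact: tile_model].
Qed.

Lemma exact_action_exists : exists s' t' : {perm T}, [/\ forall w, Ker w -> ev_word s' t' w = 1,
  N * diff (u * x) s' <= 5 * #|T| & N * diff (v * y 0) t' <= 5 * #|T| ].
Proof.
have [t [qt mt Nt]] := quasi_tiling_exists.
exact: model_transfer (quasi_tiling_model qt) mt Nt.
Qed.
End Windows.


(** * From almost actions to actions *)

(* There are finitely many actions on at most [B] points, so finitely many elements of [Ker]
   suffice to detect those which do not factor. *)
Lemma bounded_relators (Ker : word -> Prop) (B : nat) :
  exists E : seq word, (forall w, w \in E -> Ker w) /\
  forall (T : finType) (s t : {perm T}) (C : {set T}), #|C| <= B ->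
    (forall c, (s c \in C) = (c \in C)) -> (forall c, (t c \in C) = (c \in C)) ->
    (forall w c, w \in E -> c \in C -> ev_word s t w c = c) ->
    forall w c, Ker w -> c \in C -> ev_word s t w c = c.
Proof.
pose bad n (pq : {perm 'I_n} * {perm 'I_n}) w := Ker w /\ ev_word pq.1 pq.2 w <> 1.
pose pickw n pq := if pselect (exists w, @bad n pq w) is left h then [:: projT1 (cid h)] else [::].
exists (flatten [seq flatten [seq pickw n pq | pq <- enum {: {perm 'I_n} * {perm 'I_n}}]
  | n <- iota 0 B.+1]); split.
  move=> w /flattenP[ws /mapP[n _ ->]] /flattenP[vs /mapP[pq _ ->]].
  rewrite /pickw; case: pselect => // h; rewrite inE => /eqP ->.
  by case: (cid h) => w' [].
move=> T s t C CB sC tC fixE w c Kw cC.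
pose F := enum_rank_in cC.
have Finj : {in C &, injective F} by exact: enum_rank_in_inj.
have [p [pF _]] := transfer_perm Finj sC; have [q [qF _]] := transfer_perm Finj tC.
have morph w' c' : c' \in C -> ev_word p q w' (F c') = F (ev_word s t w' c').
  exact: ev_word_morph_in.
have evC w' c' : c' \in C -> ev_word s t w' c' \in C.
  elim: w' c' => [|[i j] w' IH] c' c'C /=; first by rewrite perm1.
  rewrite permM; apply: IH.
  have sV e : (s^-1 e \in C) = (e \in C) by rewrite -sC permKV.
  have tV e : (t^-1 e \in C) = (e \in C) by rewrite -tC permKV.
  by case: i; case: j; rewrite ?tV ?sV ?tC ?sC.
have triv : ev_word p q w = 1.
  apply: contrapT => ne.
  have [w' w'E [Kw' ne']] : exists2 w', w' \in pickw _ (p, q) & bad _ (p, q) w'.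
    rewrite /pickw; case: pselect => [h|[]]; last by exists w.
    by exists (projT1 (cid h)); rewrite ?inE //; case: (cid h).
  apply: ne'; apply/permP => i; rewrite perm1.
  have -> : i = F (enum_val i) by rewrite /F enum_valK_in.
  rewrite morph ?enum_valP // fixE ?enum_valP //.
  apply/flattenP; exists (flatten [seq pickw _ pq | pq <- enum {: {perm 'I_#|C|} * {perm 'I_#|C|}}]).
    by apply/mapP; exists #|C|; rewrite // mem_iota /= add0n ltnS.
  by apply/flattenP; exists (pickw _ (p, q)) => //; apply: map_f; rewrite mem_enum.
by apply: Finj; rewrite ?evC // -morph // triv perm1.
Qed.

Lemma diff_mul (T : finType) (p q p' q' : {perm T}) :
  diff (p * q) (p' * q') <= diff p p' + diff q q'.
Proof.
have sub : [set z | (p * q) z != (p' * q') z] \subset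
    [set z | p z != p' z] :|: p @^-1: [set z | q z != q' z].
  apply/subsetP => z; rewrite !inE !permM; apply: contraR.
  by rewrite negb_or !negbK => /andP[/eqP <-].
apply: leq_trans (subset_leq_card sub) _; apply: leq_trans (leq_card_setU _ _) _.
by rewrite card_preimset //; exact: perm_inj.
Qed.

Lemma diff_refl (T : finType) (p : {perm T}) : diff p p = 0%N.
Proof. by rewrite /diff (_ : [set z | _] = set0) ?cards0 //; apply/setP => z; rewrite !inE eqxx. Qed.

Lemma diff_sym (T : finType) (p q : {perm T}) : diff p q = diff q p.
Proof. by apply: eq_card => z; rewrite !inE eq_sym. Qed.

Lemma diff_trans (T : finType) (q p r : {perm T}) : diff p r <= diff p q + diff q r.
Proof.
apply: leq_trans (leq_card_setU _ _); apply/subset_leq_card/subsetP => z; rewrite !inE.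
by apply: contraR; rewrite negb_or !negbK => /andP[/eqP ->].
Qed.

Lemma diff_inv (T : finType) (p q : {perm T}) : diff p^-1 q^-1 = diff p q.
Proof.
have H (p' q' : {perm T}) : diff p'^-1 q'^-1 <= diff p' q'.
  have sub : p'^-1 @: [set z | p'^-1 z != q'^-1 z] \subset [set z | p' z != q' z].
    apply/subsetP => _ /imsetP[z + ->]; rewrite !inE permKV; apply: contraNN => /eqP e.
    by rewrite {2}e permK.
  by have := subset_leq_card sub; rewrite card_imset //; exact: perm_inj.
by apply/eqP; rewrite eqn_leq H /=; have := H p^-1 q^-1; rewrite !invgK.
Qed.

Lemma diff_ev_word (T : finType) (s s' t t' : {perm T}) w :
  diff (ev_word s t w) (ev_word s' t' w) <= size w * (diff s s' + diff t t').
Proof.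
elim: w => [|[i j] w IH] /=; first by rewrite diff_refl.
apply: leq_trans (diff_mul _ _ _ _) _; rewrite mulSn; apply: leq_add IH.
by case: i; case: j; rewrite ?diff_inv ?leq_addl ?leq_addr.
Qed.

(** There are [2 * N * N] rounds, each gaining a part [1 / (2 N ^ 2)]. The window size comes from
    [card_periodic] with [L = 8 * N * m] at the largest scale [m]. In the orbit bound,
    [window_size N * (CQ * 3 ^ window_size N)] bounds a tile, and the factor [N] makes it negligible
    in a large orbit. *)
Definition top_scale N := scale N (2 * N * N).
Definition window_size N := (2 * top_scale N + 8 * N * top_scale N * top_scale N)%N.
Definition orbit_bound N CQ := (N * (window_size N * (CQ * 3 ^ window_size N)))%N.

(** * Good points, short orbits and the choice of [G0] *)

Section NearAction.
Variables (Ker : word -> Prop) (N CQ : nat) (T : finType) (u v x : {perm T})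
  (y : nat -> {perm T}) (bad FB : {set T}).
Let K := window_size N.
Let B := orbit_bound N CQ.
Hypotheses (Ker_lamp : forall w, Ker w -> lamp_trivial w)
  (Ker_uv : forall w, Ker w -> ev_word u v w = 1) (N0 : 0 < N)
  (yC : forall i j, i < K -> j < K -> commute (y i) (y j))
  (y3 : forall i, i < K -> y i ^+ 3 = 1)
  (uy : forall i, i < K -> commute u (y i)) (vy : forall i, i < K -> commute v (y i))
  (CQ_bound : forall z, #|porb (window u v y 0 0) z| <= CQ)
  (bad_y : forall z l, z \notin bad -> l.+1 < K -> y l (x z) = x (y l.+1 z))
  (bad_u : forall z, z \notin bad -> u (x z) = x (u z))
  (bad_v : forall z, z \notin bad -> v (x z) = x (v z))
  (FB_small : forall C : {set T}, #|C| <= B ->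
    (forall c, ((u * x) c \in C) = (c \in C)) -> (forall c, ((v * y 0) c \in C) = (c \in C)) ->
    (forall c, c \in C -> c \notin FB) ->
    forall w c, Ker w -> c \in C -> ev_word (u * x) (v * y 0) w c = c)
  (bad_loss : 8 * N * (CQ * 3 ^ K * (2 * K.+1 * #|bad|)) <= #|T|)
  (FB_loss : 8 * N * (B * #|FB|) <= #|T|).

Local Notation window := (window u v y).
Local Notation gorb := (porb (ambient u v x y)).

Let nbad : {set T} :=
  \bigcup_(p : bool * 'I_K.+1) (if p.1 then x ^+ p.2 else x ^- p.2) @: bad.

(** Avoiding [nbad] gives the shift relations along [K] steps in both directions; requiring this on
    the entire window orbit makes [X] invariant under the window. *)
Let X : {set T} := [set z | [forall w in porb (window 0 K) z, w \notin nbad]].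

Let X_good z j : z \in X -> j <= K -> (x ^+ j) z \notin bad /\ (x ^- j) z \notin bad.
Proof.
rewrite inE => /forall_inP/(_ z (porb_id _ z)) zN jK.
have jK' : j < K.+1 by [].
split; apply: contra zN => h; apply/bigcupP.
  by exists (false, Ordinal jK') => //=; apply/imsetP; exists ((x ^+ j) z) => //; rewrite permK.
by exists (true, Ordinal jK') => //=; apply/imsetP; exists ((x ^- j) z) => //; rewrite permKV.
Qed.

Let XG g z : g \in window 0 K -> z \in X -> g z \in X.
Proof.
move=> gA; rewrite !inE => /forall_inP H; apply/forall_inP => w wz; apply: H.
by rewrite (porb_eq (porb_gen gA (porb_id _ z))) in wz.
Qed.

Let xy z l j : z \in X -> l + j < K -> y l ((x ^+ j) z) = (x ^+ j) (y (l + j) z).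
Proof.
move=> zX; elim: j l => [|j IH] l lt; first by rewrite expg0 !perm1 addn0.
rewrite expgSr !permM bad_y; [|by case: (X_good zX (j := j)) => //; lia|by lia].
by rewrite IH ?addSnnS //; lia.
Qed.

Let xg g z j : (forall z, z \notin bad -> g (x z) = x (g z)) ->
  z \in X -> j <= K -> g ((x ^+ j) z) = (x ^+ j) (g z).
Proof.
move=> bg zX; elim: j => [|j IH] lt; first by rewrite expg0 !perm1.
by rewrite expgSr !permM bg ?IH //; [lia | case: (X_good zX (ltnW lt))].
Qed.


Let xVy z l j : z \in X -> l + j < K -> y (l + j) ((x ^- j) z) = (x ^- j) (y l z).
Proof.
move=> zX; elim: j l => [|j IH] l lt; first by rewrite expg0 !invg1 !perm1 addn0.
have e w : (x ^- j.+1) w = x^-1 ((x ^- j) w) by rewrite expgS invMg permM.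
rewrite !e -IH; last by lia.
apply: (@perm_inj _ x); rewrite permKV.
have := @bad_y ((x ^- j.+1) z) (l + j); rewrite e permKV addnS => -> //; last by lia.
by rewrite -e; case: (X_good zX (j := j.+1)) => //; lia.
Qed.

Let xVg g z j : (forall z, z \notin bad -> g (x z) = x (g z)) ->
  z \in X -> j <= K -> g ((x ^- j) z) = (x ^- j) (g z).
Proof.
move=> bg zX; elim: j => [|j IH] lt; first by rewrite expg0 !invg1 !perm1.
have e w : (x ^- j.+1) w = x^-1 ((x ^- j) w) by rewrite expgS invMg permM.
rewrite !e -IH; last by lia.
apply: (@perm_inj _ x); rewrite permKV.
have := @bg ((x ^- j.+1) z); rewrite e permKV => -> //.
by rewrite -e; case: (X_good zX lt).
Qed.

Let card_nbad : #|nbad| <= 2 * K.+1 * #|bad|.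
Proof.
rewrite /nbad (eq_bigl (fun p => p \in [set: bool * 'I_K.+1])); last by move=> p; rewrite inE.
apply: leq_trans (card_bigcup_le (n := #|bad|) _) _.
  by move=> p _; exact: leq_imset_card.
by rewrite cardsT card_prod card_bool card_ord.
Qed.

Let orb_le z : #|porb (window 0 K) z| <= CQ * 3 ^ K.
Proof. exact: (@card_orb_le _ _ _ _ _ yC y3 uy vy _ CQ_bound). Qed.

Let X_loss : 8 * N * #|~: X| <= #|T|.
Proof.
apply: leq_trans bad_loss; rewrite leq_mul2l; apply/orP; right.
have sub : ~: X \subset \bigcup_(w in nbad) porb (window 0 K) w.
  apply/subsetP => z; rewrite !inE negb_forall_in => /exists_inP[w wz].
  by rewrite negbK => wN; apply/bigcupP; exists w => //; exact: porb_sym.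
apply: leq_trans (subset_leq_card sub) _.
apply: leq_trans (card_bigcup_le (n := CQ * 3 ^ K) (fun w _ => orb_le w)) _.
by rewrite mulnC leq_mul2l card_nbad orbT.
Qed.

Let G0 : {set T} := [set z | `[< forall w c, Ker w -> c \in gorb z ->
  ev_word (u * x) (v * y 0) w c = c >] ].

(** A short orbit without points of [FB] carries a genuine action and lies in [G0]. The other short
    orbits each contain a point of [FB] and have at most [B] points. *)
Let small_loss : 8 * N * #|small u v x y B :\: G0| <= #|T|.
Proof.
apply: leq_trans FB_loss; rewrite leq_mul2l; apply/orP; right.
pose FS := FB :&: small u v x y B.
have sub : small u v x y B :\: G0 \subset \bigcup_(f in FS) gorb f.
  apply/subsetP => z; rewrite inE => /andP[zG zs].
  have [f fz fF] : exists2 f, f \in gorb z & f \in FB.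
    apply: contrapT => no; move/negP: zG; apply; rewrite inE; apply/asboolP.
    have closed g h : g \in ambient u v x y -> h \in ambient u v x y ->
        forall c, ((g * h) c \in gorb z) = (c \in gorb z).
      move=> gA hA c; rewrite permM; apply/idP/idP; last by move=> h'; do 2 apply: porb_gen => //.
      by move=> h'; rewrite -(porb_eq h'); apply/porb_sym/porb_gen/porb_gen/porb_id.
    apply: FB_small.
    - by move: zs; rewrite inE.
    - by apply: closed; [exact: ambient_u | exact: ambient_x].
    - by apply: closed; [exact: ambient_v | exact: ambient_y].
    by move=> c cz; apply/negP => cF; apply: no; exists c.
  apply/bigcupP; exists f; last exact: porb_sym.
  by rewrite inE fF /= inE (porb_eq fz); move: zs; rewrite inE.
apply: leq_trans (subset_leq_card sub) _.
apply: (@leq_trans (#|FS| * B)).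
  by apply: card_bigcup_le => f; rewrite inE => /andP[_]; rewrite inE.
by rewrite mulnC leq_mul2l subset_leq_card ?orbT // subsetIl.
Qed.

Lemma near_action : exists s' t' : {perm T}, [/\ forall w, Ker w -> ev_word s' t' w = 1,
  N * diff (u * x) s' <= 5 * #|T| & N * diff (v * y 0) t' <= 5 * #|T| ].
Proof.
apply: (@exact_action_exists _ u v x y K yC y3 uy vy X XG xy _ _ xVy _ _ CQ B
  CQ_bound _ G0 N _ N0 _ X_loss small_loss (top_scale N) _ _ Ker) => //.
- by move=> z j; apply: xg.
- by move=> z j; apply: xg.
- by move=> z j; apply: xVg.
- by move=> z j; apply: xVg.
- by rewrite /B /orbit_bound -/K leq_pmull.
- move=> g z gA; rewrite !inE => /asboolP H; apply/asboolP => w c Kw cz; apply: H => //.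
  by rewrite (porb_eq (porb_gen gA (porb_id _ z))) in cz.
by move=> w z Kw; rewrite inE => /asboolP; apply => //; exact: porb_id.
Qed.
End NearAction.

(* The words [g] generate a finite subgroup of the group of [a] and [b]: [inv] is a complete
   invariant, with finitely many values, of the positive words in [g]. *)
Section FiniteCorrection.
Variables (d : nat -> nat) (a b : prodSym d) (g : seq word) (I : finType) (inv : seq nat -> I).
Let Ker := in_ker a b.
Let ev n w := ev_word (a n) (b n) w.

Definition spell (mu : seq nat) : word := flatten [seq nth [::] g i | i <- mu].
Definition valid (mu : seq nat) := all (fun i => i < size g) mu.

Hypothesis inv_ev : forall mu nu, valid mu -> valid nu -> inv mu = inv nu ->
  forall n, ev n (spell mu) = ev n (spell nu).

Lemma spell_cat mu nu : spell (mu ++ nu) = spell mu ++ spell nu.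
Proof. by rewrite /spell map_cat flatten_cat. Qed.

Let Ker_eq w w' : Ker (w ++ winv w') <-> forall n, ev n w = ev n w'.
Proof.
split=> H n; have := H n; rewrite /ev ?ev_word_cat ?ev_winv.
  by move/eqP; rewrite -eq_mulgV1 => /eqP.
by move=> ->; rewrite mulgV.
Qed.

Let rep i : word :=
  if pselect (exists2 mu, valid mu & inv mu = i) is left h then spell (sval (cid2 h)) else [::].

Let repP mu : valid mu -> forall n, ev n (rep (inv mu)) = ev n (spell mu).
Proof.
move=> vm n; rewrite /rep; case: pselect => [h|[]]; last by exists mu.
by case: (cid2 h) => nu vn /= e; exact: inv_ev.
Qed.

(** Up to [Ker], [W] is a finite set of words closed under products; [E] below is its multiplication
    table. *)
Let W : seq word := [::] :: g ++ [seq rep i | i <- enum I].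

Let W_spell w : w \in W -> exists2 mu, valid mu & w = spell mu.
Proof.
rewrite in_cons mem_cat => /or3P[/eqP ->|wg|/mapP[i _ ->]].
- by exists [::].
- exists [:: index w g]; first by rewrite /= index_mem wg.
  by rewrite /spell /= nth_index // cats0.
rewrite /rep; case: pselect => [h|_]; last by exists [::].
by case: (cid2 h) => nu vn _ /=; exists nu.
Qed.

Let W_rep mu : valid mu -> exists2 w, w \in W & forall n, ev n w = ev n (spell mu).
Proof.
move=> vm; exists (rep (inv mu)); last exact: repP.
by rewrite in_cons mem_cat map_f ?orbT // mem_enum.
Qed.

Let E : seq word := [seq w <- [seq w1 ++ p.1 ++ winv p.2 |
  w1 <- W, p <- [seq (w2, w3) | w2 <- W, w3 <- W]] | `[< Ker w >] ].

(** On the set [G] of points whose images under [W] all avoid [F], the multiplication table holds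
    exactly, so [G] is invariant and the words act on it as the finite group does. Elsewhere the
    corrected generators are the identity. The complement of [G] is a union of [size W] preimages of
    [F]. *)
Lemma finite_correction : exists (C0 : nat) (E : seq word), (forall w, w \in E -> Ker w) /\
  forall (T : finType) (s t : {perm T}) (F : {set T}),
  (forall w z, w \in E -> z \notin F -> ev_word s t w z = z) ->
  exists p : nat -> {perm T},
    (forall mu nu, valid mu -> valid nu -> (forall n, ev n (spell mu) = ev n (spell nu)) ->
       \prod_(i <- mu) p i = \prod_(i <- nu) p i) /\
    (forall i, i < size g -> diff (p i) (ev_word s t (nth [::] g i)) <= C0 * #|F|).
Proof.
exists (size W), E; split=> [w|T s t F EF].
  by rewrite mem_filter => /andP[/asboolP].
pose rho w := ev_word s t w.
have rel w1 w2 w3 z : w1 \in W -> w2 \in W -> w3 \in W ->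
    (forall n, ev n w3 = ev n w1 * ev n w2) -> z \notin F -> rho w2 (rho w1 z) = rho w3 z.
  move=> w1W w2W w3W e zF; have /EF/(_ zF) : w1 ++ w2 ++ winv w3 \in E.
    rewrite mem_filter; apply/andP; split.
      by apply/asboolP; rewrite catA; apply/Ker_eq => n; rewrite e /ev ev_word_cat.
    apply/allpairsPdep; exists w1, (w2, w3); split=> //.
    by apply/allpairsPdep; exists w2, w3.
  rewrite !ev_word_cat ev_winv !permM => h.
  by apply: (@perm_inj _ (ev_word s t w3)^-1); rewrite h permK.
have W0 : [::] \in W by rewrite mem_head.
pose G := [set z | all (fun w => rho w z \notin F) W].
have GP z : z \in G -> forall w, w \in W -> rho w z \notin F.
  by rewrite inE => /allP.
have GF z : z \in G -> z \notin F by move=> /GP/(_ _ W0); rewrite /rho /= perm1.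
have mul_rep w1 w2 : w1 \in W -> w2 \in W ->
    exists2 w3, w3 \in W & forall n, ev n w3 = ev n w1 * ev n w2.
  move=> /W_spell[mu vm ->] /W_spell[nu vn ->].
  have [|w3 w3W e3] := @W_rep (mu ++ nu); first by rewrite /valid all_cat; apply/andP.
  by exists w3 => // n; rewrite e3 spell_cat /ev ev_word_cat.
have GW z w : w \in W -> z \in G -> rho w z \in G.
  move=> wW zG; rewrite inE; apply/allP => w2 w2W.
  have [w3 w3W e3] := mul_rep w w2 wW w2W.
  by rewrite (rel w w2 w3) //; [exact: GP | exact: GF].
have gW i : i < size g -> nth [::] g i \in W.
  by move=> lt; rewrite in_cons mem_cat mem_nth ?orbT.
pose h i z := if (z \in G) && (i < size g) then rho (nth [::] g i) z else z.
have h_inj i : injective (h i).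
  move=> z z'; rewrite /h; have [lt|_] := boolP (i < size g); last by rewrite !andbF.
  rewrite !andbT; case: ifP => zG; case: ifP => zG'; first exact: perm_inj.
  - by move=> e; move: zG'; rewrite -e GW // gW.
  - by move=> e; move: zG; rewrite e GW // gW.
  by [].
pose p i := perm (@h_inj i).
have prod_out mu z : z \notin G -> (\prod_(i <- mu) p i) z = z.
  move=> zG; elim: mu => [|i mu IH]; first by rewrite big_nil perm1.
  by rewrite big_cons permM permE /h (negPf zG) /= IH.
have prod_in mu z w : valid mu -> z \in G -> w \in W ->
    (forall n, ev n w = ev n (spell mu)) -> (\prod_(i <- mu) p i) z = rho w z.
  move=> + zG; elim/last_ind: mu w => [|mu i IH] w vm wW ew.
    rewrite big_nil perm1 -[RHS](rel [::] [::] w) ?GF //; first by rewrite /rho /= !perm1.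
    by move=> n; rewrite ew /ev /= mulg1.
  move: vm; rewrite /valid all_rcons => /andP[lt vm].
  have [w0 w0W e0] := W_rep vm.
  rewrite -cats1 big_cat big_seq1 permM (IH w0) // permE /h GW //= lt.
  rewrite (rel w0 _ w) ?gW ?GF // => n.
  by rewrite ew -cats1 spell_cat e0 /ev ev_word_cat /spell /= cats0.
exists p; split=> [mu nu vm vn e|i lt].
  apply/permP => z; have [zG|zG] := boolP (z \in G); last by rewrite !prod_out.
  have [w wW ew] := W_rep vm.
  by rewrite (prod_in mu z w) // (prod_in nu z w) // => n; rewrite ew e.
have sub : [set z | p i z != ev_word s t (nth [::] g i) z] \subset
    \bigcup_(k < size W) (rho (nth [::] W k)) @^-1: F.
  apply/subsetP => z; rewrite inE permE /h lt andbT; case: ifP => [_|zG _].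
    by rewrite eqxx.
  move/negbT: zG; rewrite inE => /allPn[w wW]; rewrite negbK => wF.
  have k : index w W < size W by rewrite index_mem.
  by apply/bigcupP; exists (Ordinal k) => //=; rewrite inE nth_index.
apply: leq_trans (subset_leq_card sub) _.
rewrite (eq_bigl (fun k => k \in [set: 'I_(size W)])); last by move=> k; rewrite inE.
apply: leq_trans (card_bigcup_le (n := #|F|) _) _.
  by move=> k _; rewrite card_preimset //; exact: perm_inj.
by rewrite cardsT card_ord.
Qed.
End FiniteCorrection.

Lemma card_has_le (T : finType) (I : Type) (P : I -> pred T) (ws : seq I) :
  #|[set z | has (fun w => P w z) ws]| <= \sum_(w <- ws) #|[set z | P w z]|.
Proof.
elim: ws => [|w ws IH]; first by rewrite big_nil leqn0 cards_eq0; apply/eqP/setP => z; rewrite !inE.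
rewrite big_cons; apply: leq_trans (leq_add (leqnn _) IH).
apply: leq_trans (leq_card_setU _ _); apply/subset_leq_card/subsetP => z.
by rewrite !inE.
Qed.

(** * The group of the theorem: relators and approximation of almost actions *)

Section Approximation.
Variables (d r : nat -> nat).
Hypotheses (dP : forall n, prime (d n) /\ 5 <= d n)
  (r_homo : {homo r : m n / m < n}) (r0 : forall n, 0 < r n)
  (rd : forall n, 3 * r n <= d n).
Variables (N : nat) (N0 : 0 < N).

Let al : prodSym d := fun n => alpha_perm (d n).
Let be : prodSym d := fun n => beta_perm (d n) (r n).
Let Ker := in_ker al be.
Let ev n w := ev_word (al n) (be n) w.
Let K := window_size N.
Let d0 n : 0 < d n. Proof. by have [] := dP n; lia. Qed.

Let K0 : 0 < K.
Proof.
have : 0 < top_scale N by apply: leq_trans N0 _; exact: (scale_mono N0 (leq0n _)).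
by rewrite /K /window_size; move: (top_scale N) => n; case: n => // n _; rewrite mulnS.
Qed.

Let lt_r n l : K <= n -> l < K -> l < r n.
Proof. by have := index_lt_r r_homo r0 n; lia. Qed.

Section Words.
Variables (wU wV : word).
Hypotheses (U_lo : forall n, n < K -> ev n wU = al n) (U_hi : forall n, K <= n -> ev n wU = 1)
  (V_lo : forall n, n < K -> ev n wV = be n) (V_hi : forall n, K <= n -> ev n wV = 1).

(** [wx] and [wy] spell the tails of the two generators, and [wY l] the conjugates of the second
    tail by powers of the first. *)
Let wx : word := winv wU ++ [:: (false, false)].
Let wy : word := winv wV ++ [:: (true, false)].
Let wY l : word := flatten (nseq l wx) ++ wy ++ winv (flatten (nseq l wx)).
(* The inverses of [wU] and [wV] are listed because [spell] only forms positive words. *)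
Let gens : seq word := [:: wU; wV; winv wU; winv wV] ++ [seq wY l | l <- iota 0 K].
Let val n i := ev n (nth [::] gens i).
(** The default value 1 for [l >= K] makes commutation and order 3 hold for all indices, as
    [prodY_eq] requires. *)
Let tailY n l : {perm 'I_(d n)} := if l < K then al n ^+ l * be n * al n ^- l else 1.

Let size_gens : size gens = (4 + K)%N. Proof. by rewrite /= size_map size_iota. Qed.

Let nth_gens l : l < K -> nth [::] gens (4 + l) = wY l.
Proof. by move=> lK; rewrite /= (nth_map 0) ?size_iota // nth_iota. Qed.

Let ev_wx n : ev n wx = if n < K then 1 else al n.
Proof.
rewrite /ev ev_word_cat ev_winv /= mulg1; case: ltnP => h.
  by have := U_lo h; rewrite /ev => ->; rewrite mulVg.
by have := U_hi h; rewrite /ev => ->; rewrite invg1 mul1g.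
Qed.

Let ev_wy n : ev n wy = if n < K then 1 else be n.
Proof.
rewrite /ev ev_word_cat ev_winv /= mulg1; case: ltnP => h.
  by have := V_lo h; rewrite /ev => ->; rewrite mulVg.
by have := V_hi h; rewrite /ev => ->; rewrite invg1 mul1g.
Qed.

Let ev_wY n l : ev n (wY l) = ev n wx ^+ l * ev n wy * ev n wx ^- l.
Proof. by rewrite /ev ev_word_cat (ev_word_cat _ _ wy) ev_winv ev_word_nseq mulgA. Qed.

Let val_Y_lo n l : n < K -> l < K -> val n (4 + l) = 1.
Proof. by move=> nK lK; rewrite /val nth_gens // ev_wY ev_wx ev_wy nK expg1n !mul1g invg1. Qed.

Let val_Y_hi n l : K <= n -> l < K -> val n (4 + l) = tailY n l.
Proof.
by move=> nK lK; rewrite /val nth_gens // ev_wY ev_wx ev_wy ltnNge nK /= /tailY lK.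
Qed.

Let tailYC n i j : K <= n -> commute (tailY n i) (tailY n j).
Proof.
move=> nK; rewrite /tailY; case: ifP => iK; case: ifP => jK; try exact: commute1.
- by apply: (beta_conj_commute2 (d0 n) (r0 n) (rd n)); apply: lt_r.
- exact/commute_sym/commute1.
Qed.

Let tailY3 n i : K <= n -> tailY n i ^+ 3 = 1.
Proof.
move=> nK; rewrite /tailY; case: ifP => iK; last exact: expg1n.
have -> : al n ^+ i * be n * al n ^- i = be n ^ (al n ^- i) by rewrite conjgE invgK mulgA.
by rewrite -conjXg beta_order ?conj1g.
Qed.

Let ev_spell n mu : ev n (spell gens mu) = \prod_(i <- mu) val n i.
Proof. by rewrite /ev /spell ev_word_flatten big_map. Qed.

(** The indices 0 to 3 in [gens] are words of [Q], trivial at coordinates from [K] on; index [4 + l]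
    is lamp [l]. *)
Let lamps (mu : seq nat) : seq (nat * nat) := [seq (i - 4, 1%N) | i <- mu & 4 <= i].

Let net_lamps l mu : net l (lamps mu) = count (pred1 (4 + l)) mu.
Proof.
elim: mu => //= i mu IH; rewrite /lamps /=; case: (ltnP 3 i) => h /=; rewrite -/(lamps mu).
  rewrite /net /=; have -> : (i == 4 + l) = (i - 4 == l) by lia.
  by case: (i - 4 == l) => /=; rewrite -IH.
by rewrite IH; have -> : (i == 4 + l) = false by lia.
Qed.

Let ev_spell_hi n mu : K <= n -> valid gens mu ->
  ev n (spell gens mu) = prodY (tailY n) (lamps mu).
Proof.
move=> nK vm; rewrite ev_spell; elim: mu vm => [|i mu IH] /=; first by rewrite /prodY !big_nil.
rewrite big_cons /lamps /= => /andP[lt /IH ->]; case: (ltnP 3 i) => h /=; rewrite -/(lamps mu).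
  rewrite /prodY big_cons /= expg1 -/(prodY _ _); congr (_ * _).
  rewrite -val_Y_hi //; last by move: lt; rewrite ?size_map ?size_iota; clear -h; lia.
  by congr val; lia.
have -> : val n i = 1; last by rewrite mul1g.
case: i h {lt IH} => [|[|[|[|i]]]] // _; rewrite /val /=.
- exact: U_hi.
- exact: V_hi.
- by rewrite /ev ev_winv; have := U_hi nK; rewrite /ev => ->; rewrite invg1.
by rewrite /ev ev_winv; have := V_hi nK; rewrite /ev => ->; rewrite invg1.
Qed.

Definition spell_type : finType :=
  ({dffun forall i : 'I_K, {perm 'I_(d i)}} * {ffun 'I_K -> 'I_3})%type.

(** The first component determines the value at the first [K] coordinates. At the later ones only
    the commuting lamps remain, and their exponents modulo 3 suffice. *)
Let inv (mu : seq nat) : spell_type :=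
  (finfun (fun i : 'I_K => ev i (spell gens mu) : {perm 'I_(d i)}),
   [ffun l : 'I_K => inord (count (pred1 (4 + l)) mu %% 3)]).

Let inv_ev mu nu : valid gens mu -> valid gens nu -> inv mu = inv nu ->
  forall n, ev n (spell gens mu) = ev n (spell gens nu).
Proof.
move=> vm vn [/ffunP lo /ffunP hi] n; have [nK|nK] := ltnP n K.
  by have := lo (Ordinal nK); rewrite !ffunE.
rewrite !ev_spell_hi //; apply: prodY_eq => [i j|i|l]; [exact: tailYC | exact: tailY3 |].
rewrite !net_lamps; have [lK|lK] := ltnP l K.
  have := hi (Ordinal lK); rewrite !ffunE => /(congr1 (@nat_of_ord 3)).
  by rewrite !inordK ?ltn_mod.
have out m : valid gens m -> count (pred1 (4 + l)) m = 0%N.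
  move=> /allP vm'; apply/eqP; rewrite -leqn0 leqNgt -has_count; apply/negP => /hasP[i im /eqP e].
  by have := vm' _ im; rewrite e size_gens; lia.
by rewrite !out.
Qed.

Let same mu nu := forall n, ev n (spell gens mu) = ev n (spell gens nu).

Let val_lo n : n < K -> [/\ val n 0 = al n, val n 1%N = be n, val n 2 = (al n)^-1
  & val n 3 = (be n)^-1].
Proof.
move=> nK; rewrite /val /=; split; [exact: U_lo | exact: V_lo | |]; rewrite /ev ev_winv.
  by have := U_lo nK; rewrite /ev => ->.
by have := V_lo nK; rewrite /ev => ->.
Qed.

Let val_hi n : K <= n -> [/\ val n 0 = 1, val n 1%N = 1, val n 2 = 1 & val n 3 = 1].
Proof.
move=> nK; rewrite /val /=; split; [exact: U_hi | exact: V_hi | |]; rewrite /ev ev_winv.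
  by have := U_hi nK; rewrite /ev => ->; rewrite invg1.
by have := V_hi nK; rewrite /ev => ->; rewrite invg1.
Qed.

Let rel_inv i : i < 2 -> same [:: i; i + 2]%N [::].
Proof.
move=> i2 n; rewrite !ev_spell !big_cons !big_nil mulg1.
have [/val_lo[h0 h1 h2 h3]|/val_hi[h0 h1 h2 h3]] := ltnP n K.
  by case: i i2 => [|[|i]] // _; rewrite ?h0 ?h1 ?h2 ?h3 mulgV.
by case: i i2 => [|[|i]] // _; rewrite ?h0 ?h1 ?h2 ?h3 mulg1.
Qed.

Let rel_uvy i l : i < 2 -> l < K -> same [:: i; 4 + l]%N [:: 4 + l; i]%N.
Proof.
move=> i2 lK n; rewrite !ev_spell !big_cons !big_nil !mulg1.
have [nK|/val_hi[h0 h1 h2 h3]] := ltnP n K; first by rewrite val_Y_lo // mulg1 mul1g.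
by case: i i2 => [|[|i]] // _; rewrite ?h0 ?h1 mulg1 mul1g.
Qed.

Let rel_yy i j : i < K -> j < K -> same [:: 4 + i; 4 + j]%N [:: 4 + j; 4 + i]%N.
Proof.
move=> iK jK n; rewrite !ev_spell !big_cons !big_nil !mulg1.
have [nK|nK] := ltnP n K; first by rewrite !val_Y_lo.
by rewrite !val_Y_hi //; exact: tailYC.
Qed.

Let rel_y3 i : i < K -> same [:: 4 + i; 4 + i; 4 + i]%N [::].
Proof.
move=> iK n; rewrite !ev_spell !big_cons !big_nil !mulg1.
have [nK|nK] := ltnP n K; first by rewrite !val_Y_lo // !mulg1.
by rewrite !val_Y_hi //; have := tailY3 i nK; rewrite !expgS expg0 mulg1.
Qed.

Let code (l : letter) : nat := if l.1 then (if l.2 then 3 else 1%N) else (if l.2 then 2 else 0%N).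

(** Spelled with [wU] and [wV], a word of [Ker] keeps its value on the first [K] coordinates and
    becomes trivial on the others. Hence the corrected [u], [v] satisfy all relations of the group,
    not just finitely many. *)
Let rel_ker w : Ker w -> same [seq code l | l <- w] [::].
Proof.
move=> kw n; rewrite !ev_spell big_nil big_map; have [nK|nK] := ltnP n K.
  have [h0 h1 h2 h3] := val_lo nK; rewrite -[RHS](kw n).
  elim: (w) => [|[[] []] w' IH]; rewrite ?big_nil // big_cons IH /=.
  - by rewrite h3. - by rewrite h1. - by rewrite h2. - by rewrite h0.
have [h0 h1 h2 h3] := val_hi nK.
by elim: (w) => [|[[] []] w' IH]; rewrite ?big_nil // big_cons IH /code /= ?h0 ?h1 ?h2 ?h3 mulg1.
Qed.

Let valid_code w : valid gens [seq code l | l <- w].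
Proof. by apply/allP => _ /mapP[[[] []] _ ->]; rewrite size_gens. Qed.

Let valid_Y l : l < K -> 4 + l < size gens.
Proof. by move=> lK; rewrite size_gens ltn_add2l. Qed.

Let comm_word w : word := wx ++ w ++ winv wx ++ winv w.

(** [wx] and [w] live on complementary sets of coordinates. *)
Let comm_ker w : (w = wU) \/ (w = wV) -> Ker (comm_word w).
Proof.
move=> hw n; rewrite -/(ev n _); have -> : ev n (comm_word w) =
    ev n wx * (ev n w * ((ev n wx)^-1 * (ev n w)^-1)).
  by rewrite /ev /comm_word ev_word_cat (ev_word_cat _ _ w) (ev_word_cat _ _ (winv wx)) !ev_winv.
rewrite ev_wx; have [nK|nK] := ltnP n K; first by rewrite invg1 !mul1g mulgV.
by case: hw => ->; rewrite ?U_hi ?V_hi // invg1 mulg1 mul1g mulgV.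
Qed.

Let CQ := #|{: spell_type}|.
Let B := orbit_bound N CQ.

Lemma nearby_action_of_words : exists (C : nat) (E : seq word), (forall w, w \in E -> Ker w) /\
  forall (T : finType) (s t : {perm T}) (F : {set T}),
  (forall w z, w \in E -> z \notin F -> ev_word s t w z = z) -> C * #|F| <= #|T| ->
  exists s' t' : {perm T}, [/\ forall w, Ker w -> ev_word s' t' w = 1,
    N * diff s s' <= 6 * #|T| & N * diff t t' <= 6 * #|T| ].
Proof.
have [C0 [E1 [E1K corr]]] := finite_correction inv_ev.
have [E2 [E2K small]] := bounded_relators Ker B.
pose E3 := [:: comm_word wU; comm_word wV].
(* [c1] accounts for at most [K] shift relations and the commutations of [x] with [u] and [v]; [c2]
   for [F] itself and for the change of [t] into [v * y 0] in the relators of [E2]. The constant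
   below makes the three resulting losses admissible at once. *)
pose c1 := ((K + 2) * (4 * C0 + 1))%N.
pose c2 := (1 + (\sum_(w <- E2) size w) * (2 * C0))%N.
exists (8 * N * (CQ * 3 ^ K * (2 * K.+1 * c1)) + (8 * N * (B * c2) + N * (2 * C0)))%N.
exists (E1 ++ E2 ++ E3); split.
  move=> w; rewrite !mem_cat !inE => /or3P[/E1K|/E2K|] // /orP[] /eqP ->; apply: comm_ker; auto.
move=> T s t F EF CF.
have CF1 : 8 * N * (CQ * 3 ^ K * (2 * K.+1 * c1)) * #|F| <= #|T|.
  by apply: leq_trans CF; rewrite leq_mul2r leq_addr orbT.
have CF2 : 8 * N * (B * c2) * #|F| <= #|T|.
  apply: leq_trans CF; rewrite leq_mul2r; apply/orP; right.
  by apply: leq_trans (leq_addl _ _); exact: leq_addr.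
have CF3 : N * (2 * C0) * #|F| <= #|T|.
  apply: leq_trans CF; rewrite leq_mul2r; apply/orP; right.
  by apply: leq_trans (leq_addl _ _); exact: leq_addl.
have [p [prel pdiff]] := corr T s t F (fun w z wE => EF w z ltac:(by rewrite mem_cat wE)).
(* [x] is defined from the corrected [u], so that [u * x] is exactly [s]; only [t] is changed, into
   [v * y 0]. *)
pose u := p 0; pose v := p 1%N; pose y l := p (4 + l)%N; pose x := u^-1 * s.
pose rho w := ev_word s t w.
have rel mu nu : valid gens mu -> valid gens nu -> same mu nu ->
  \prod_(i <- mu) p i = \prod_(i <- nu) p i by exact: prel.
have uy i : i < K -> commute u (y i).
  move=> iK; have := rel _ _ _ _ (rel_uvy (isT : 0 < 2) iK).
  by rewrite !big_cons !big_nil !mulg1; apply; rewrite /valid /= ?valid_Y.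
have vy i : i < K -> commute v (y i).
  move=> iK; have := rel _ _ _ _ (rel_uvy (isT : 1 < 2) iK).
  by rewrite !big_cons !big_nil !mulg1; apply; rewrite /valid /= ?valid_Y.
have yC i j : i < K -> j < K -> commute (y i) (y j).
  move=> iK jK; have := rel _ _ _ _ (rel_yy iK jK).
  by rewrite !big_cons !big_nil !mulg1; apply; rewrite /valid /= ?valid_Y.
have y3 i : i < K -> y i ^+ 3 = 1.
  move=> iK; have := rel _ _ _ _ (rel_y3 iK).
  by rewrite !big_cons !big_nil !mulg1 !expgS expg0 mulg1; apply; rewrite /valid /= ?valid_Y.
have puV : p 2 = u^-1.
  have := rel _ _ _ _ (rel_inv (isT : 0 < 2)); rewrite !big_cons !big_nil !mulg1 => h.
  by apply/esym/eqP; rewrite eq_invg_mul; apply/eqP/h.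
have pvV : p 3 = v^-1.
  have := rel _ _ _ _ (rel_inv (isT : 1 < 2)); rewrite !big_cons !big_nil !mulg1 => h.
  by apply/esym/eqP; rewrite eq_invg_mul; apply/eqP/h.
have code_prod w : \prod_(i <- [seq code l | l <- w]) p i = ev_word u v w.
  rewrite big_map; elim: w => [|[[] []] w IH]; rewrite ?big_nil // big_cons IH /code /=.
  - by rewrite pvV. - by []. - by rewrite puV. - by [].
have Ker_uv w : Ker w -> ev_word u v w = 1.
  move=> kw; rewrite -code_prod; have := rel _ _ (valid_code w) _ (rel_ker kw).
  by rewrite big_nil; apply.
have CQ_bound z : #|porb (window u v y 0 0) z| <= CQ.
  (* A point of the orbit under [u] and [v] is reached by a positive product, which depends only on
     its invariant; so the number of invariants bounds the orbit. *)
  pose h (i : spell_type) := if pselect (exists2 mu, valid gens mu & inv mu = i) is left e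
    then (\prod_(i <- sval (cid2 e)) p i) z else z.
  have hP mu : valid gens mu -> h (inv mu) = (\prod_(i <- mu) p i) z.
    move=> vm; rewrite /h; case: pselect => [e|[]]; last by exists mu.
    by case: (cid2 e) => nu vn /= en; rewrite (rel nu mu) // => n; exact: inv_ev.
  have sub : porb (window u v y 0 0) z \subset [set h i | i in [set: spell_type]].
    apply/subsetP => w wz; have [mu vm ->] : exists2 mu, valid gens mu & w = (\prod_(i <- mu) p i) z.
      move: wz; apply: (@porb_ind _ _ z (fun w => exists2 mu, valid gens mu & _)).
        by exists [::]; rewrite // big_nil perm1.
      move=> g w' gA _ [mu vm ->].
      have [i i2 ->] : exists2 i, i < 2 & g = p i.
        by case/windowP: gA => [->|->|[l //]]; [exists 0%N | exists 1%N].
      exists (rcons mu i); last by rewrite -cats1 big_cat big_seq1 permM.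
      rewrite /valid all_rcons; apply/andP; split; last exact: vm.
      by rewrite size_gens; move: i2; clear; lia.
    by apply/imsetP; exists (inv mu); rewrite ?inE ?hP.
  apply: leq_trans (subset_leq_card sub) _; apply: leq_trans (leq_imset_card _ _) _.
  by rewrite cardsT.
have dg i : i < size gens -> diff (p i) (rho (nth [::] gens i)) <= C0 * #|F| by exact: pdiff.
have du : diff u (rho wU) <= C0 * #|F| by exact: (dg 0).
have dv : diff v (rho wV) <= C0 * #|F| by exact: (dg 1%N).
have dy l : l < K -> diff (y l) (rho (wY l)) <= C0 * #|F|.
  by move=> lK; rewrite -nth_gens //; apply: dg; exact: valid_Y.
have dx : diff x (rho wx) <= C0 * #|F|.
  rewrite /rho ev_word_cat ev_winv /= mulg1; apply: leq_trans (diff_mul _ _ _ _) _.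
  by rewrite diff_inv diff_refl addn0.
have d2 (a a' b b' : {perm T}) : diff a a' <= C0 * #|F| -> diff b b' <= C0 * #|F| ->
    diff (a * b) (a' * b') <= 2 * C0 * #|F|.
  move=> h1 h2; apply: leq_trans (diff_mul _ _ _ _) _.
  by apply: leq_trans (leq_add h1 h2) _; rewrite -mulnA mul2n addnn.
have d4 (a a' b b' : {perm T}) : diff a a' <= C0 * #|F| -> diff b b' <= C0 * #|F| ->
    diff (a' * b') (b' * a') <= #|F| -> diff (a * b) (b * a) <= (4 * C0 + 1) * #|F|.
  move=> h1 h2 h3; have := d2 _ _ _ _ h1 h2; have := d2 _ _ _ _ h2 h1.
  have := diff_trans (a' * b') (a * b) (b * a); have := diff_trans (b' * a') (a' * b') (b * a).
  by rewrite (diff_sym (b' * a')); move: h3; rewrite mulnDl mul1n -!mulnA; clear; lia.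
have dcomm w : w \in E3 -> forall w', w = comm_word w' -> diff (rho wx * rho w') (rho w' * rho wx) <= #|F|.
  move=> wE w' e; apply/subset_leq_card/subsetP => z; rewrite inE; apply: contraR => zF.
  have := EF w z; rewrite !mem_cat wE !orbT => /(_ isT zF).
  rewrite e /comm_word ev_word_cat (ev_word_cat _ _ w') (ev_word_cat _ _ (winv wx)) !ev_winv !permM.
  move=> h; apply/eqP; have := congr1 (rho w') h; rewrite /rho permKV => <-.
  by rewrite permKV.
(* The shift relation between the words is an identity in the free group, so it fails for [x] and
   the [y l] only through the corrections. *)
have eY l : rho wx * rho (wY l) = rho (wY l.+1) * rho wx.
  have E k : rho (wY k) = rho wx ^+ k * rho wy * rho wx ^- k.
    by rewrite /rho ev_word_cat (ev_word_cat _ _ wy) ev_winv ev_word_nseq mulgA.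
  by rewrite !E !mulgA -expgS expgS invMg !mulgA mulgKV.
pose bad : {set T} := (\bigcup_(l in [set: 'I_K])
    (if l.+1 < K then [set z | (x * y l) z != (y l.+1 * x) z] else set0)) :|:
  ([set z | (x * u) z != (u * x) z] :|: [set z | (x * v) z != (v * x) z]).
have bad_le : #|bad| <= c1 * #|F|.
  rewrite /c1 mulnAC mulnDr [X in _ <= X](_ : _ =
    K * ((4 * C0 + 1) * #|F|) + ((4 * C0 + 1) * #|F| + (4 * C0 + 1) * #|F|))%N; last first.
    by move: #|F|; clear; lia.
  apply: leq_trans (leq_card_setU _ _) _; apply: leq_add.
    rewrite -[X in _ <= X * _](card_ord K) -cardsT; apply: card_bigcup_le => l _.
    case: ifP => lK; last by rewrite cards0.
    have h1 := d2 _ _ _ _ dx (dy l (ltn_ord l)); have h2 := d2 _ _ _ _ (dy l.+1 lK) dx.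
    have h4 : diff (rho wx * rho (wY l)) (y l.+1 * x) <= 2 * C0 * #|F| by rewrite eY diff_sym.
    apply: leq_trans (diff_trans (rho wx * rho (wY l)) _ _) _.
    apply: leq_trans (leq_add h1 h4) _; rewrite -mulnDl leq_mul2r; apply/orP; right.
    by clear; lia.
  apply: leq_trans (leq_card_setU _ _) _; apply: leq_add.
    by apply: d4 dx du (dcomm (comm_word wU) _ wU _); rewrite // inE eqxx.
  by apply: d4 dx dv (dcomm (comm_word wV) _ wV _); rewrite // !inE eqxx orbT.
have badP z : z \notin bad -> [/\ forall l, l.+1 < K -> y l (x z) = x (y l.+1 z),
    u (x z) = x (u z) & v (x z) = x (v z)].
  rewrite !in_setU !negb_or => /and3P[h1 h2 h3]; split.
  - move=> l lK; move/bigcupP: h1 => h1; apply/eqP/negPn/negP => ne; apply: h1.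
    exists (Ordinal (ltnW lK)); rewrite ?in_setT //.
    have -> : (Ordinal (ltnW lK)).+1 < K by exact: lK.
    by rewrite inE (permM x) (permM (y _)).
  - by move: h2; rewrite inE negbK (permM x) (permM u) => /eqP.
  by move: h3; rewrite inE negbK (permM x) (permM v) => /eqP.
have ds : diff s (u * x) = 0%N by rewrite /x mulKVg diff_refl.
have dt : diff t (v * y 0) <= 2 * C0 * #|F|.
  have -> : t = rho wV * rho (wY 0).
    have -> : wY 0 = wy ++ [::] by [].
    by rewrite /rho ev_word_cat (ev_word_cat _ _ (winv wV)) ev_winv /= !mulg1 mulKVg.
  by rewrite diff_sym; apply: d2 dv (dy 0%N K0).
pose FB : {set T} := F :|: [set z | has (fun w => rho w z != ev_word (u * x) (v * y 0) w z) E2].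
have FB_le : #|FB| <= c2 * #|F|.
  apply: leq_trans (leq_card_setU _ _) _; rewrite /c2 mulnDl mul1n leq_add2l.
  apply: leq_trans (card_has_le _ _) _; rewrite -mulnA big_distrl /=; apply: leq_sum => w _.
  by apply: leq_trans (diff_ev_word _ _ _ _ _) _; rewrite ds add0n leq_mul2l dt orbT.
have [] := @near_action Ker N CQ T u v x y bad FB _ Ker_uv N0 yC y3 uy vy CQ_bound.
- by move=> w; apply: in_ker_lamp_trivial => // n; exact: index_lt_r.
- by move=> z l /badP[h _ _]; exact: h.
- by move=> z /badP[].
- by move=> z /badP[].
- move=> C CB uC vC CFB w c kw cC; apply: (small T _ _ C) kw cC => // w' c' w'E c'C.
  have := CFB c' c'C; rewrite !inE negb_or => /andP[c'F /hasPn/(_ w' w'E)].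
  by rewrite negbK => /eqP <-; apply: EF => //; rewrite !mem_cat w'E orbT.
- apply: leq_trans CF1.
  apply: (@leq_trans (8 * N * (CQ * 3 ^ K * (2 * K.+1 * (c1 * #|F|))))).
    by do 3 (rewrite leq_mul2l; apply/orP; right).
  by rewrite !mulnA.
- apply: leq_trans CF2.
  apply: (@leq_trans (8 * N * (B * (c2 * #|F|)))).
    by do 2 (rewrite leq_mul2l; apply/orP; right).
  by rewrite !mulnA.
move=> s' [t' [kill hs ht]]; exists s', t'; split=> //.
  by move: hs; rewrite /x mulKVg => /leq_trans; apply; rewrite leq_mul2r orbT.
apply: leq_trans (leq_mul (leqnn N) (diff_trans (v * y 0) t t')) _.
rewrite [X in X <= _]mulnDr [X in _ <= X]mulSn; apply: leq_add ht.
apply: leq_trans CF3.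
by rewrite -mulnA leq_mul2l dt orbT.
Qed.
End Words.

Lemma nearby_action : exists (C : nat) (E : seq word), (forall w, w \in E -> Ker w) /\
  forall (T : finType) (s t : {perm T}) (F : {set T}),
  (forall w z, w \in E -> z \notin F -> ev_word s t w z = z) -> C * #|F| <= #|T| ->
  exists s' t' : {perm T}, [/\ forall w, Ker w -> ev_word s' t' w = 1,
    N * diff s s' <= 6 * #|T| & N * diff t t' <= 6 * #|T| ].
Proof.
have [wU [U_lo U_hi]] := truncate dP r_homo r0 rd K [:: (false, false)].
have [wV [V_lo V_hi]] := truncate dP r_homo r0 rd K [:: (true, false)].
apply: (@nearby_action_of_words wU wV) => // n nK.
  by rewrite /ev U_lo //= mulg1.
by rewrite /ev V_lo //= mulg1.
Qed.
End Approximation.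

(** A spelling is chosen for each element of the group; two spellings differ by a word of the
    kernel, so the choice does not matter. The value 1 outside the group is arbitrary. *)
Lemma hom_of_killed (m : nat -> nat) (a b : prodSym m) (T : finType) (s t : {perm T}) :
  (forall w, in_ker a b w -> ev_word s t w = 1) ->
  exists phi : prodSym m -> {perm T}, forall g w,
    (forall n, g n = ev_word (a n) (b n) w) -> phi g = ev_word s t w.
Proof.
move=> kill; exists (fun g => if pselect (in_gen a b g) is left h
  then ev_word s t (projT1 (cid h)) else 1) => g w gw.
case: pselect => [h|[]]; last by exists w.
case: (cid h) => w' /= gw'; apply/eqP; rewrite eq_mulgV1; apply/eqP.
have := kill (w' ++ winv w); rewrite ev_word_cat ev_winv; apply => n.
by rewrite ev_word_cat ev_winv -gw -gw' mulgV.
Qed.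

Import Order.TTheory GRing.Theory Num.Theory.
Local Open Scope ring_scope.

Theorem theorem3p13 (d r : nat -> nat) :
  {homo d : m n / (m <= n)%N} ->
  (forall n, prime (d n) /\ (5 <= d n)%N) ->
  {homo r : m n / (m < n)%N} ->
  (forall n, (0 < r n)%N) ->
  (forall n, (3 * r n <= d n)%N) ->
  perm_stable (m := d) (fun n => alpha_perm (d n)) (fun n => beta_perm (d n) (r n)).
Proof.
move=> _ dP r_homo r0 rd eps eps0.
(* The approximation costs [6 / N] in normalized distance. *)
pose N := (Num.bound (6%:R / eps)).+1.
have Neps : 6%:R < eps * N%:R.
  rewrite mulrC -ltr_pdivrMr //; apply: lt_le_trans (archi_boundP _) _.
    by rewrite divr_ge0 ?ler0n // ltW.
  by rewrite ler_nat.
have [C [E [EK near]]] := nearby_action dP r_homo r0 rd (ltn0Sn _ : (0 < N)%N).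
(* Each relator moves at most [#|T| / D] points, so all of them together move at most [#|T| / C];
   the successor keeps [D] positive when [C] or [E] vanishes. *)
pose D := (C * size E).+1.
exists (D%:R^-1); split; first by rewrite invr_gt0 ltr0n /= invf_le1 ?ltr0n // ler1n.
exists E; split=> // T s t Esmall.
pose F := [set z | has (fun w => ev_word s t w z != z) E].
have EF w z : w \in E -> z \notin F -> ev_word s t w z = z.
  by move=> wE; rewrite inE => /hasPn/(_ w wE); rewrite negbK => /eqP.
have moved w : w \in E -> (D * #|[set z | ev_word s t w z != z]| <= #|T|)%N.
  move=> /Esmall; rewrite /hdist.
  have -> : [set z | ev_word s t w z != (1%g : {perm T}) z] = [set z | ev_word s t w z != z].
    by apply/setP => z; rewrite !inE perm1.
  have [T0|T0] := posnP #|T|.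
    by move=> _; have := max_card [set z | ev_word s t w z != z]; rewrite T0 leqn0 => /eqP ->; rewrite muln0.
  rewrite ltr_pdivrMr ?ltr0n // mulrC -ltr_pdivrMr ?invr_gt0 ?ltr0n // invrK -natrM ltr_nat mulnC.
  exact: ltnW.
have CF : (C * #|F| <= #|T|)%N.
  have := card_has_le (fun w z => ev_word s t w z != z) E; rewrite -/F => FE.
  have {}FE : (D * #|F| <= size E * #|T|)%N.
    apply: leq_trans (leq_mul (leqnn D) FE) _; rewrite big_distrr /= -sum1_size big_distrl /=.
    rewrite big_seq [X in (_ <= X)%N]big_seq; apply: leq_sum => w wE; rewrite mul1n.
    exact: moved.
  have [E0|E0] := posnP (size E).
    move: FE; rewrite E0 mul0n /D E0 muln0 mul1n leqn0 => /eqP ->; by rewrite muln0.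
  rewrite -(leq_pmul2l E0); apply: leq_trans FE.
  by rewrite mulnA leq_mul2r mulnC leqnSn orbT.
have [s' [t' [kill ds dt]]] := near T s t F EF CF.
have [phi phiE] := hom_of_killed kill.
exists phi; split.
  move=> g h [w gw] [w' hw']; rewrite (phiE g w gw) (phiE h w' hw') -ev_word_cat.
  by apply: phiE => n; rewrite ev_word_cat /prod_mul gw hw'.
have close (p q : {perm T}) : (N * diff p q <= 6 * #|T|)%N -> hdist p q < eps.
  rewrite /hdist -/(diff p q) => le.
  (* On an empty set the distance is 0, since the inverse of 0 is 0. *)
  have [T0|T0] := posnP #|T|; first by rewrite T0 invr0 mulr0.
  rewrite ltr_pdivrMr ?ltr0n // -(ltr_pM2l (_ : 0 < N%:R)) ?ltr0n // -natrM.
  apply: (@le_lt_trans _ _ (6 * #|T|)%:R); first by rewrite ler_nat.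
  by rewrite natrM mulrCA mulrA ltr_pM2r ?ltr0n.
have phi_a : phi (fun n => alpha_perm (d n)) = s'.
  by rewrite (phiE _ [:: (false, false)]) ?mulg1 //= => [|n]; rewrite ?mulg1.
have phi_b : phi (fun n => beta_perm (d n) (r n)) = t'.
  by rewrite (phiE _ [:: (true, false)]) ?mulg1 //= => [|n]; rewrite ?mulg1.
by rewrite phi_a phi_b; split; apply: close.
Qed.
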